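(* For the $2$-sphere of radius $R>0$ with the subspace metric, the magnitude is given by $$\bigl|S^2_{\mathrm{sub},R}\bigr|=\frac{2R^2}{1-e^{-2R}(1+2R)}=2R^2+O(R^{-1})\quad\text{as }R\to\infty.$$ For the $2$-sphere of radius $R$ with the intrinsic metric, the magnitude is given by $$\bigl|S^2_R\bigr|=\frac{2R^2+2}{1+e^{-\pi R}}=2R^2+2+O(R^{-1})\quad\text{as }R\to\infty.$$ Thus the sub-leading terms of the asymptotic behaviour are different for the two different metrics.
   Context: $S^2_{\mathrm{sub},R}$ denotes the sphere of radius $R$ in $\mathbb{R}^3$ with the subspace metric, i.e. the restriction of the Euclidean distance of $\mathbb{R}^3$. $S^2_R$ denotes the same sphere with its intrinsic metric: the distance between two points is the infimum of the lengths of the paths in the sphere joining them. A weight measure on a metric space $(X,d)$ is a finite signed Borel measure $\nu$ on $X$ such that $\int_{x\in X}e^{-d(x,y)}\,d\nu(x)=1$ for all $y\in X$. If a weight measure $\nu$ exists on $X$, the magnitude of $X$ is defined to be its total mass $|X|:=\nu(X)$ (which does not depend on the choice of weight measure). *)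

(* Defs.v *)
From HB Require Import structures.
From mathcomp Require Export all_boot all_order all_algebra.
From mathcomp Require Export all_classical all_reals all_analysis.

Set Implicit Arguments.
Unset Strict Implicit.
Unset Printing Implicit Defensive.

Import Order.TTheory GRing.Theory Num.Theory.
Export numFieldNormedType.Exports.

Local Open Scope classical_set_scope.
Local Open Scope ring_scope.

(* Lets +oo be the filter of a Landau notation. *)
Canonical pinfty_filter_on (R : realType) : filter_on R :=
  FilterType (pinfty_nbhs R) _.

(* The value does not depend on the Hahn decomposition
   (Hahn_decomposition_uniq), so an arbitrary one is chosen. *)
Definition charge_integral (d : measure_display) (T : measurableType d)
    (R : realType) (nu : {charge set T -> \bar R}) (f : T -> \bar R) : \bar R :=
  let P := cid (Hahn_decomposition nu) in
  let N := cid (projT2 P) in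
  (\int[jordan_pos (projT2 N)]_x f x - \int[jordan_neg (projT2 N)]_x f x)%E.

Section magnitude.
Context {R : realType} {X : pointedType}.

(* A metric space is given as a carrier X with an explicit distance function,
   since the same carrier is considered below with two different metrics; its
   Borel sigma-algebra is the one generated by the open sets of that metric. *)
Implicit Type dist : X -> X -> R.

Definition metric_open dist : set (set X) :=
  [set U | forall x, U x ->
    exists2 e : R, 0 < e & forall y, dist x y < e -> U y].

Definition borel dist := g_sigma_algebraType (metric_open dist).

(* Charges take finite values on measurable sets: they are the finite signed
   measures. *)
Definition weight_measure dist (nu : {charge set (borel dist) -> \bar R}) :=
  forall y : X, charge_integral nu (fun x => (expR (- dist x y))%:E) = 1%E.

Definition has_weight_measure dist := exists nu, @weight_measure dist nu.

(* Total mass of a weight measure; 0 if there is none. *)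
Definition magnitude dist : R :=
  xget 0 [set m : R |
    exists2 nu, @weight_measure dist nu & nu [set: borel dist] = m%:E].

End magnitude.

(* Euclidean distance; the norm which the library puts on 'rV[R]_n is the
   maximum norm, with the same topology. *)
Definition edist {R : realType} {n : nat} (p q : 'rV[R]_n) : R :=
  Num.sqrt (\sum_(i < n) (p 0 i - q 0 i) ^+ 2).

Definition curve_length {R : realType} {n : nat} (a b : R)
    (g : R -> 'rV[R]_n) : \bar R :=
  ereal_sup [set (let F := g \o nth b (a :: s) in
                  \sum_(0 <= k < size s) edist (F k) (F k.+1))%:E
            | s in itv_partition a b].

Section sphere.
Context {R : realType}.

Definition sphere (r : R) : Type :=
  {p : 'rV[R]_3 | \sum_(i < 3) p 0 i ^+ 2 == r ^+ 2}.

Variable r : R.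

HB.instance Definition _ := Choice.on (sphere r).

Let pole : 'rV[R]_3 := \row_(i < 3) (if i == 0 then r else 0).

Fact pole_in_sphere : \sum_(i < 3) pole 0 i ^+ 2 == r ^+ 2.
Proof.
by rewrite !big_ord_recl big_ord0 !mxE/= expr0n/= !addr0.
Qed.

HB.instance Definition _ := isPointed.Build (sphere r)
  (exist _ pole pole_in_sphere : sphere r).

Definition sub_dist (p q : sphere r) : R := edist (sval p) (sval q).

Definition sphere_path (p q : sphere r) (g : R -> sphere r) :=
  [/\ {within `[0, 1], continuous (fun t => sval (g t) : 'rV[R]_3)},
      g 0 = p & g 1 = q].

(* Any two points are joined by a path of finite length, so that fine does not
   meet +oo. *)
Definition intrinsic_dist (p q : sphere r) : R :=
  fine (ereal_inf [set curve_length 0 1 (fun t => sval (g t))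
                  | g in sphere_path p q]).

End sphere.

(* Main.v *)
From HB Require Import structures.
Require Import Defs.
From mathcomp Require Import ring lra measurable_realfun.

(** The sphere is homogeneous, so its uniform measure has a constant potential
    for every kernel [exp (- h (cos of the angle between x and y))]; rescaled to
    potential 1 it is a weight measure, of total mass 2 / J where J is the
    integral of [exp (- h u)] over [-1, 1].  Both distances have this form:
    the chord is [h u = r sqrt (2 - 2 u)], the geodesic distance is
    [h u = r acos u].  It remains to compute J by an explicit antiderivative and
    to see that the exponential terms decay faster than every power of r.

    _Constant potential._  By the theorem of Archimedes the uniform measure is
    the image of the uniform law on [-1, 1] x [-pi, pi] under cylindrical
    coordinates (z, t).  What has to be shown is the Funk-Hecke formula
    ([funk_hecke]): the cosine u of the angle to an arbitrary point q is uniform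
    on [-1, 1], as z is.  Let c, s be the cosine and sine of the angle from the
    pole to q.  For fixed z, u is an affine function of a cosine, so its law is
    an arcsine law ([arcsine_substitution]), and the joint law of (z, u) has a
    density proportional to
      [1 / sqrt (s ^ 2 - z ^ 2 - u ^ 2 + 2 c z u)],
    the inverse square root of a Gram determinant, which is symmetric in z and
    u.  Hence z and u have the same law.

    _Independence of the weight measure._  If nu is a weight measure with Jordan
    parts nu+ and nu-, and m is the uniform weight measure, integrating the
    kernel against the product of m with nu+ and with nu- in both orders
    (Tonelli) gives nu+ (X) = m (X) + nu- (X), so that nu (X) = m (X)
    ([weight_measure_mass]).

    _Geodesic distance._  With [angle p q] the angle at the centre,
    [intrinsic_distE] says that the intrinsic distance is [r * angle p q].  A
    great circle gives the upper bound.  For the lower bound, the angle to p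
    varies continuously along a path from p to q, so by the intermediate value
    theorem the path has a partition on which it grows by equal steps d; the
    chord over each step is at least r d cos (d / 2) by the nonnegativity of a
    Gram determinant, and d tends to 0. *)

Set Implicit Arguments.
Unset Strict Implicit.
Unset Printing Implicit Defensive.

Import Order.TTheory GRing.Theory Num.Theory.

Local Open Scope classical_set_scope.
Local Open Scope ring_scope.

Local Notation mu := lebesgue_measure.

(** * The arcsine law *)

Definition affine_cos (R : realType) (a b t : R) : R := a + b * cos t.

Lemma is_derive_affine_cos (R : realType) (a b t : R) :
  is_derive t 1 (affine_cos a b) (- (b * sin t)).
Proof.
rewrite /affine_cos.
by apply: is_derive_eq; rewrite add0r mul1r /GRing.scale /= mulrN.
Qed.

Lemma derive1_affine_cos (R : realType) (a b : R) :
  derive1 (affine_cos a b) = (fun t => - (b * sin t)).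
Proof.
apply/funext => t; rewrite derive1E; have := is_derive_affine_cos a b t.
by move=> h; apply: derive_val.
Qed.

Lemma continuous_affine_cos (R : realType) (a b : R) :
  continuous (affine_cos a b).
Proof.
move=> t; apply: cvgD; first exact: cvg_cst.
by apply: cvgMr; exact: continuous_cos.
Qed.

Lemma affine_cos_dec (R : realType) (a b : R) : 0 < b ->
  {in `[0, pi] &, {mono (affine_cos a b) : x y /~ x < y}}.
Proof.
by move=> b0 x y xI yI; rewrite ltrD2l ltr_pM2l// ltr_cos.
Qed.

Lemma affine_cos_itv (R : realType) (a b t : R) : 0 < b -> t \in `]0, pi[ ->
  affine_cos a b t \in `]a - b, a + b[.
Proof.
move=> b0 tI; have := affine_cos_dec a b0.
move=> h; rewrite in_itv/=.
have -> : a - b = affine_cos a b pi by rewrite /affine_cos cospi mulrN1.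
have -> : a + b = affine_cos a b 0 by rewrite /affine_cos cos0 mulr1.
have I0 : (0 : R) \in `[0, pi] by rewrite in_itv/= lexx pi_ge0.
have Ipi : (pi : R) \in `[0, pi] by rewrite in_itv/= lexx pi_ge0.
have tI' := subset_itv_oo_cc tI.
by rewrite !h// andbC; move: tI; rewrite in_itv.
Qed.

Lemma radicand_gt0 (R : realType) (a b u : R) : u \in `]a - b, a + b[ ->
  0 < b ^+ 2 - (u - a) ^+ 2.
Proof. by rewrite in_itv/= => /andP[? ?]; nra. Qed.

Lemma arcsine_kernel_cos (R : realType) (a b t : R) : 0 < b -> t \in `]0, pi[ ->
  (Num.sqrt (b ^+ 2 - (affine_cos a b t - a) ^+ 2))^-1 * (b * sin t) = 1.
Proof.
move=> b0; rewrite in_itv /= => /sin_gt0_pi st.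
rewrite (_ : b ^+ 2 - _ = (b * sin t) ^+ 2); last first.
  by rewrite exprMn sin2cos2 /affine_cos; ring.
by rewrite sqrtr_sqr gtr0_norm ?mulr_gt0// mulVf// gt_eqF// mulr_gt0.
Qed.

Lemma continuous_arcsine_kernel (R : realType) (a b u : R) :
  u \in `]a - b, a + b[ ->
  {for u, continuous (fun u => (Num.sqrt (b ^+ 2 - (u - a) ^+ 2))^-1)}.
Proof.
move=> /radicand_gt0 h.
have cp : {for u, continuous (fun u : R => b ^+ 2 - (u - a) ^+ 2)}.
  apply: cvgB; first exact: cvg_cst.
  apply: (@continuous_comp _ _ _ (fun u => u - a) (fun x : R => x ^+ 2)).
    by apply: cvgB; [exact: cvg_id|exact: cvg_cst].
  exact: exprn_continuous.
have cs := continuous_comp cp (@sqrt_continuous R _).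
by apply: (cvgV _ cs); rewrite /= gt_eqF// sqrtr_gt0.
Qed.

(** Away from the endpoints the arcsine density is continuous, and this is the
    substitution u = a + b cos t, which has du = - b sin t dt. *)
Lemma arcsine_substitution_cc (R : realType) (a b e d : R) (g : R -> R) :
  0 < b -> 0 < e -> e <= d -> d < pi -> continuous g ->
  (\int[mu]_(u in `[affine_cos a b d, affine_cos a b e])
     (g u * (Num.sqrt (b ^+ 2 - (u - a) ^+ 2))^-1)%:E =
   \int[mu]_(t in `[e, d]) (g (affine_cos a b t))%:E)%E.
Proof.
move=> b0 e0 ed dpi cg.
have sub t : t \in `[e, d] -> t \in `]0, pi[.
  rewrite !in_itv/= => /andP[et tpi].
  by rewrite (lt_le_trans e0 et)/= (le_lt_trans tpi).
have subc t : t \in `[e, d] -> t \in `[0, pi].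
  by move=> /sub; apply: subset_itv_oo_cc.
pose F := affine_cos a b.
pose G u := g u * (Num.sqrt (b ^+ 2 - (u - a) ^+ 2))^-1.
have cF' : continuous F^`()%classic.
  rewrite derive1_affine_cos => t; apply: cvgN; apply: cvgMr.
  exact: continuous_sin.
rewrite (@integration_by_substitution_decreasing _ F G e d)//.
- apply: eq_integral => t; rewrite inE/= => tI; congr (_%:E).
  rewrite /G derive1_affine_cos !fctE /F opprK -mulrA arcsine_kernel_cos ?mulr1//.
  exact: sub.
- by move=> x y xI yI; rewrite affine_cos_dec ?subc.
- by apply/cvg_ex; exists (F^`()%classic e); apply: cvg_at_right_filter; exact: cF'.
- by apply/cvg_ex; exists (F^`()%classic d); apply: cvg_at_left_filter; exact: cF'.
- split.
  + by move=> t _; have [] := is_derive_affine_cos a b t.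
  + by apply: cvg_at_right_filter; exact: continuous_affine_cos.
  + by apply: cvg_at_left_filter; exact: continuous_affine_cos.
- apply: continuous_subspace_itv => u uI.
  apply: cvgM; first exact: cg.
  apply: continuous_arcsine_kernel; move: uI.
  have := affine_cos_itv a b0 (sub e _).
  have := affine_cos_itv a b0 (sub d _).
  rewrite !in_itv /= !lexx ed => /(_ isT) /andP[h1 _] /(_ isT) /andP[_ h2].
  by move=> /andP[u1 u2]; rewrite (lt_le_trans h1)// (le_lt_trans u2).
Qed.

Lemma bigcup_itv_cc_oo (R : realType) (a b : R) (x y : nat -> R) :
  (forall n, a < x n) -> (forall n, y n < b) ->
  x n @[n --> \oo] --> a -> y n @[n --> \oo] --> b ->
  \bigcup_n `[x n, y n]%classic = `]a, b[%classic.
Proof.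
move=> ax yb xa yb'; apply/seteqP; split.
  move=> u [n _] /=; rewrite !in_itv/= => /andP[h1 h2].
  by rewrite (lt_le_trans (ax n) h1) (le_lt_trans h2 (yb n)).
move=> u /=; rewrite in_itv/= => /andP[au ub].
have [n _ hn] : \forall n \near \oo, x n < u /\ u < y n.
  by near=> n; split; near: n; [exact: (cvgr_lt a)|exact: (cvgr_gt b)].
exists n => //=; have [h1 h2] := hn n (leqnn n).
by rewrite in_itv/= !ltW.
Unshelve. all: end_near. Qed.

(** The density blows up at a - b and a + b, so the identity is obtained by
    exhausting the open interval by closed ones. *)
Lemma arcsine_substitution (R : realType) (a b : R) (g : R -> R) :
  0 < b -> continuous g -> (forall u, 0 <= g u) ->
  (\int[mu]_(u in [set` `]a - b, a + b[%R])
     (g u * (Num.sqrt (b ^+ 2 - (u - a) ^+ 2))^-1)%:E =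
   \int[mu]_(t in `]0%R, pi[) (g (affine_cos a b t))%:E)%E.
Proof.
move=> b0 cg g0.
pose e (n : nat) : R := n.+1%:R^-1.
pose d n := pi - e n.
have e0 n : 0 < e n by rewrite invr_gt0.
have e1 n : e n <= 1 by rewrite invf_le1// ler1n.
have ed n : e n <= d n.
  by rewrite /d; have := pi_ge2 R; have := e1 n; lra.
have dpi n : d n < pi by rewrite /d; have := e0 n; lra.
have eI n : e n \in `]0, pi[ by rewrite in_itv/= e0 (le_lt_trans (ed n)).
have dI n : d n \in `]0, pi[ by rewrite in_itv/= dpi (lt_le_trans (e0 n)).
have ee m n : (m <= n)%N -> e n <= e m by move=> mn; rewrite lef_pV2 ?posrE// ler_nat.
have cvge : e n @[n --> \oo] --> (0 : R) by exact: cvg_harmonic.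
have cvgd : d n @[n --> \oo] --> (pi : R).
  by rewrite -[X in _ --> X]subr0; apply: cvgB => //; exact: cvg_cst.
pose F := affine_cos a b.
have F0 : F 0 = a + b by rewrite /F /affine_cos cos0 mulr1.
have Fpi : F pi = a - b by rewrite /F /affine_cos cospi mulrN1.
have U1 : `]a - b, a + b[%classic = \bigcup_n `[F (d n), F (e n)]%classic.
  rewrite (@bigcup_itv_cc_oo _ (a - b) (a + b))//.
  - by move=> n; have := affine_cos_itv a b0 (dI n); rewrite in_itv => /andP[].
  - by move=> n; have := affine_cos_itv a b0 (eI n); rewrite in_itv => /andP[].
  - by rewrite -Fpi; apply: continuous_cvg => //; exact: continuous_affine_cos.
  - by rewrite -F0; apply: continuous_cvg => //; exact: continuous_affine_cos.
have U2 : `]0, pi[%classic = \bigcup_n `[e n, d n]%classic.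
  by rewrite (@bigcup_itv_cc_oo _ 0 pi).
have mg : measurable_fun setT g by exact: continuous_measurable_fun.
have mG : measurable_fun `]a - b, a + b[
    (fun u => g u * (Num.sqrt (b ^+ 2 - (u - a) ^+ 2))^-1).
  apply: measurable_funM; first exact: measurable_funTS.
  apply: open_continuous_measurable_fun; first exact: interval_open.
  by move=> u; rewrite inE/= => /continuous_arcsine_kernel.
have h1 : (\int[mu]_(u in `[F (d n), F (e n)])
     (g u * (Num.sqrt (b ^+ 2 - (u - a) ^+ 2))^-1)%:E @[n --> \oo] -->
  \int[mu]_(u in [set` `]a - b, a + b[%R])
     (g u * (Num.sqrt (b ^+ 2 - (u - a) ^+ 2))^-1)%:E)%E.
  rewrite U1; apply: ge0_nondecreasing_set_cvg_integral => //.
  - move=> m n mn; apply/subsetPset/subset_itv; rewrite bnd_simp.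
      by rewrite leNgt affine_cos_dec ?(subset_itv_oo_cc (dI _))// -leNgt lerD2l lerN2 ee.
    by rewrite leNgt affine_cos_dec ?(subset_itv_oo_cc (eI _))// -leNgt ee.
  - move=> n; apply/measurable_EFinP.
    apply: measurable_funS mG => //; rewrite U1.
    exact: (@bigcup_sup _ _ n setT (fun n => `[F (d n), F (e n)]%classic)).
  - by move=> n u _; rewrite lee_fin mulr_ge0// invr_ge0 sqrtr_ge0.
have h2 : (\int[mu]_(t in `[e n, d n])
     (g (affine_cos a b t))%:E @[n --> \oo] -->
  \int[mu]_(t in `]0%R, pi[) (g (affine_cos a b t))%:E)%E.
  rewrite U2; apply: ge0_nondecreasing_set_cvg_integral => //.
  - move=> m n mn; apply/subsetPset/subset_itv; rewrite bnd_simp ?ee//.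
    by rewrite lerD2l lerN2 ee.
  - move=> n; apply/measurable_EFinP; apply: measurable_funTS.
    apply: (measurableT_comp mg); apply: continuous_measurable_fun.
    exact: continuous_affine_cos.
  - by move=> n u _; rewrite lee_fin.
apply: cvg_unique h1 _; first exact: ereal_hausdorff.
apply: cvg_trans h2; apply: near_eq_cvg; apply: nearW => n.
by rewrite arcsine_substitution_cc.
Qed.

(** * The Funk-Hecke formula *)

(** Joint density, up to a constant, of the cosines z and u of the angles from a
    uniform random point to two fixed points whose angle has cosine c and sine s.
    Since the square root of a negative number and the inverse of 0 are both 0,
    it vanishes where no point of the sphere has these two cosines. *)
Definition latitude_kernel (R : realType) (c s z u : R) : R :=
  (Num.sqrt (s ^+ 2 - z ^+ 2 - u ^+ 2 + 2 * c * z * u))^-1.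

Lemma latitude_kernelC (R : realType) (c s z u : R) :
  latitude_kernel c s z u = latitude_kernel c s u z.
Proof. by congr (Num.sqrt _)^-1; ring. Qed.

Lemma latitude_kernel_ge0 (R : realType) (c s z u : R) :
  0 <= latitude_kernel c s z u.
Proof. by rewrite invr_ge0 sqrtr_ge0. Qed.

Lemma latitude_kernel_eq0 (R : realType) (c s z u : R) :
  s ^+ 2 - z ^+ 2 - u ^+ 2 + 2 * c * z * u <= 0 -> latitude_kernel c s z u = 0.
Proof. by move=> h; rewrite /latitude_kernel ler0_sqrtr// invr0. Qed.

Lemma measurable_latitude_kernel (R : realType) (c s : R) :
  measurable_fun setT (fun x : R * R => latitude_kernel c s x.1 x.2).
Proof.
rewrite (_ : (fun _ => _) = fun x : R * R =>
  (Num.sqrt (s ^+ 2 - x.1 ^+ 2 - x.2 ^+ 2 + 2 * c * x.1 * x.2)) `^ (-1)); last first.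
  by apply/funext => x; rewrite powR_inv1// sqrtr_ge0.
apply: (measurableT_comp (@measurable_powR R (-1))).
apply: (measurableT_comp (continuous_measurable_fun (@sqrt_continuous R))).
apply: measurable_funD; last first.
  apply: measurable_funM => //; apply: measurable_funM => //.
by apply: measurable_funB; [apply: measurable_funB => //|];
  apply: measurable_funX.
Qed.

(** Conditionally on z, the cosine u is c z + s sqrt (1 - z ^ 2) cos t with t
    uniform: its arcsine density is the kernel. *)
Lemma integral_latitude_kernel (R : realType) (c s z : R) (g : R -> R) :
  c ^+ 2 + s ^+ 2 = 1 -> 0 < s -> -1 < z < 1 ->
  continuous g -> (forall u, 0 <= g u) ->
  (\int[mu]_u (g u * latitude_kernel c s z u)%:E =
   \int[mu]_(t in `]0%R, pi[)
      (g (affine_cos (c * z) (s * Num.sqrt (1 - z ^+ 2)) t))%:E)%E.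
Proof.
move=> cs s0 /andP[z1 z2] cg g0.
have z0 : 0 < 1 - z ^+ 2 by nra.
pose a := c * z; pose b := s * Num.sqrt (1 - z ^+ 2).
have b0 : 0 < b by rewrite mulr_gt0// sqrtr_gt0.
rewrite -arcsine_substitution// [RHS]integral_mkcond; apply: eq_integral => u _.
have rad : b ^+ 2 - (u - a) ^+ 2 = s ^+ 2 - z ^+ 2 - u ^+ 2 + 2 * c * z * u.
  rewrite /b exprMn sqr_sqrtr ?ltW// /a.
  apply/eqP; rewrite -subr_eq0 [X in X == _](_ : _ = (1 - (c ^+ 2 + s ^+ 2)) * z ^+ 2).
    by rewrite cs subrr mul0r.
  by ring.
rewrite patchE; case: ifPn => [_|]; first by rewrite -/a -/b rad.
rewrite notin_setE /= in_itv/= => uI; rewrite latitude_kernel_eq0 ?mulr0//.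
rewrite -rad leNgt; apply/negP => rp; apply: uI; rewrite -/a -/b; apply/andP; split; nra.
Qed.

(** Since c ^ 2 + s ^ 2 = 1, the radicand is
    (1 - z ^ 2) (1 - c ^ 2) - (u - c z) ^ 2. *)
Lemma latitude_kernel_eq0_out (R : realType) (c s z u : R) :
  c ^+ 2 + s ^+ 2 = 1 -> ~~ (-1 < z < 1) -> latitude_kernel c s z u = 0.
Proof.
move=> cs zI; apply: latitude_kernel_eq0.
have z0 : 1 - z ^+ 2 <= 0.
  rewrite leNgt; apply/negP => zp; move/negP: zI; apply; apply/andP; split; nra.
have -> : s ^+ 2 = 1 - c ^+ 2 by rewrite -cs; ring.
suff : (1 - z ^+ 2) * (1 - c ^+ 2) - (u - c * z) ^+ 2 <= 0 by nra.
have : 0 <= (u - c * z) ^+ 2 by exact: sqr_ge0.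
have : 0 <= s ^+ 2 by exact: sqr_ge0.
have : s ^+ 2 = 1 - c ^+ 2 by rewrite -cs; ring.
by nra.
Qed.

(** The symmetry of the kernel exchanges the roles of z and u: after Tonelli the
    inner integral over z of the kernel is the total mass of an arcsine law,
    namely pi, for every u in ]-1, 1[. *)
Lemma funk_hecke_open (R : realType) (c s : R) (g : R -> R) :
  c ^+ 2 + s ^+ 2 = 1 -> 0 < s -> continuous g -> (forall u, 0 <= g u) ->
  (\int[mu]_(z in [set` `](-1), 1[%R]) 
    \int[mu]_(t in `]0%R, pi[)
      (g (affine_cos (c * z) (s * Num.sqrt (1 - z ^+ 2)) t))%:E =
   pi%:E * \int[mu]_(u in [set` `](-1), 1[%R]) (g u)%:E)%E.
Proof.
move=> cs s0 cg g0.
have mg : measurable_fun setT g by exact: continuous_measurable_fun.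
have mK := measurable_latitude_kernel c s.
transitivity (\int[mu]_z \int[mu]_u
    (g u * latitude_kernel c s z u)%:E)%E.
  rewrite integral_mkcond; apply: eq_integral => z _.
  rewrite patchE; case: ifPn => [|].
    by rewrite inE/= in_itv/= => zI; rewrite integral_latitude_kernel.
  rewrite notin_setE/= in_itv/= => /negP zI.
  by rewrite integral0_eq// => u _; rewrite latitude_kernel_eq0_out// mulr0.
rewrite (@fubini_tonelli _ _ _ _ _ lebesgue_measure lebesgue_measure
  (fun x : R * R => (g x.2 * latitude_kernel c s x.1 x.2)%:E)); last 2 first.
- apply/measurable_EFinP; apply: measurable_funM => //.
  by apply: (measurableT_comp mg).
- by move=> x; rewrite lee_fin mulr_ge0// latitude_kernel_ge0.
rewrite -ge0_integralZl//; last 3 first.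
- by apply/measurable_EFinP; exact: measurable_funTS.
- by move=> u _; rewrite lee_fin.
- by rewrite lee_fin pi_ge0.
rewrite [RHS]integral_mkcond; apply: eq_integral => u _ /=.
have -> : (\int[mu]_z (g u * latitude_kernel c s z u)%:E =
   (g u)%:E * \int[mu]_z (1 * latitude_kernel c s u z)%:E)%E.
  rewrite -ge0_integralZl//.
  - by apply: eq_integral => z _; rewrite latitude_kernelC mul1r EFinM.
  - apply/measurable_EFinP; apply: measurable_funM => //.
    exact: (measurableT_comp mK (measurable_pair1 u)).
  - by move=> z _; rewrite lee_fin mul1r latitude_kernel_ge0.
  - by rewrite lee_fin.
rewrite patchE; case: ifPn => [|].
  rewrite inE/= in_itv/= => uI.
  rewrite (@integral_latitude_kernel _ c s u (cst 1))//; last exact: cst_continuous.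
  rewrite (integral_cst _ _ 1)//= lebesgue_measure_itv/= lte_fin pi_gt0 mul1e.
  by rewrite sube0 muleC.
rewrite notin_setE/= in_itv/= => /negP uI.
by rewrite integral0_eq ?mule0// => z _; rewrite latitude_kernel_eq0_out// mulr0.
Qed.

Lemma continuous_measurable_EFin (R : realType) (D : set R) (g : R -> R) :
  continuous g -> measurable_fun D (EFin \o g).
Proof.
move=> cg; apply/measurable_EFinP; apply: measurable_funTS.
exact: continuous_measurable_fun.
Qed.

Lemma integral_itv_split (R : realType) (a b c : R) (g : R -> R) :
  a <= b -> b <= c -> continuous g -> (forall x, 0 <= g x) ->
  (\int[mu]_(x in `[a, c]) (g x)%:E =
   \int[mu]_(x in `[a, b]) (g x)%:E + \int[mu]_(x in `[b, c]) (g x)%:E)%E.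
Proof.
move=> ab bc cg g0; rewrite (@itv_bndbnd_setU _ _ _ (BRight b)) ?bnd_simp//.
rewrite ge0_integral_setU//.
- congr (_ + _)%E; rewrite integral_itv_obnd_cbnd//.
  exact: continuous_measurable_EFin.
- exact: continuous_measurable_EFin.
- by move=> x _; rewrite lee_fin.
- apply: lt_disjoint => x y; rewrite !in_itv/= => /andP[_ xb] /andP[by_ _].
  exact: le_lt_trans xb by_.
Qed.

Lemma integral_itv_shift (R : realType) (a b t : R) (g : R -> R) :
  a <= b -> continuous g ->
  (\int[mu]_(x in [set` `[a - t, b - t]%R]) (g x)%:E =
   \int[mu]_(x in `[a, b]) (g (x - t)%R)%:E)%E.
Proof.
move=> ab cg.
pose F (x : R) := x - t.
have dF (x : R) : is_derive x 1 F 1.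
  by rewrite /F; apply: is_derive_eq; rewrite subr0.
have F'E : F^`()%classic = cst 1.
  by apply/funext => x; rewrite derive1E; apply: derive_val.
have cF : continuous F by move=> x; apply: cvgB; [exact: cvg_id|exact: cvg_cst].
rewrite -/(F a) -/(F b) (@integration_by_substitution_increasing _ F g)//.
- by apply: eq_integral => x _; rewrite F'E !fctE mulr1.
- by move=> x y _ _ xy; rewrite ltrD2r.
- by rewrite F'E => x _; exact: cst_continuous.
- by rewrite F'E; exact: is_cvg_cst.
- by rewrite F'E; exact: is_cvg_cst.
- split.
  + by move=> x _; have [] := dF x.
  + by apply: cvg_at_right_filter; exact: cF.
  + by apply: cvg_at_left_filter; exact: cF.
- exact: continuous_subspaceT.
Qed.

(** The piece [-pi - t, -pi] of the shifted period is moved by one period to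
    [pi - t, pi]. *)
Lemma integral_periodic_shift (R : realType) (t : R) (g : R -> R) :
  continuous g -> (forall x, 0 <= g x) -> (forall x, g (x + 2 * pi) = g x) ->
  0 <= t <= 2 * pi ->
  (\int[mu]_(x in [set` `[- pi, pi]%R]) (g (x - t)%R)%:E =
   \int[mu]_(x in [set` `[- pi, pi]%R]) (g x)%:E)%E.
Proof.
move=> cg g0 gp /andP[t0 t2].
have pi0 := pi_gt0 R.
have npi : - pi <= pi :> R by lra.
have -> : (\int[mu]_(x in [set` `[- pi, pi]%R]) (g (x - t)%R)%:E)%E =
    (\int[mu]_(x in [set` `[- pi - t, pi - t]%R]) (g x)%:E)%E.
  by rewrite integral_itv_shift.
rewrite (@integral_itv_split _ _ (- pi)) ?lerBlDr ?lerDl//; last by lra.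
rewrite [RHS](@integral_itv_split _ _ (pi - t)) //; [|lra|lra].
rewrite addeC; congr (_ + _)%E.
have -> : - pi - t = pi - t - 2 * pi by ring.
have {1}-> : - pi = pi - 2 * pi :> R by ring.
rewrite integral_itv_shift//; last by lra.
by apply: eq_integral => x _; rewrite -[in RHS](subrK (2 * pi) x) gp.
Qed.

Lemma integral_even (R : realType) (a : R) (g : R -> R) :
  0 <= a -> continuous g -> (forall x, 0 <= g x) -> (forall x, g (- x) = g x) ->
  (\int[mu]_(x in [set` `[- a, a]%R]) (g x)%:E =
   2%:E * \int[mu]_(x in `[0%R, a]) (g x)%:E)%E.
Proof.
move=> a0 cg g0 ge.
rewrite (@integral_itv_split _ _ 0) ?oppr_le0//.
rewrite -[in `[- a, 0]]oppr0 integration_by_substitution_oppr//; last first.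
  exact: continuous_subspaceT.
under eq_integral do rewrite /= ge.
by rewrite mule_natl mule2n.
Qed.

(** On ]-1, 1[ this is a partial integral of the kernel, hence measurable by
    Tonelli; this lets the endpoints be added to the domain of z. *)
Lemma measurable_latitude_integral (R : realType) (c s : R) (g : R -> R) :
  c ^+ 2 + s ^+ 2 = 1 -> 0 < s -> continuous g -> (forall u, 0 <= g u) ->
  measurable_fun (`](-1), 1[%classic : set R) (fun z : R =>
    \int[mu]_(t in `]0%R, pi[)
      (g (affine_cos (c * z) (s * Num.sqrt (1 - z ^+ 2)) t))%:E)%E.
Proof.
move=> cs s0 cg g0.
have mg : measurable_fun setT g by exact: continuous_measurable_fun.
have mK := measurable_latitude_kernel c s.
apply: (@eq_measurable_fun _ _ _ _ _ (fun z => \int[mu]_u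
    (g u * latitude_kernel c s z u)%:E)%E).
  by move=> z; rewrite inE/= in_itv/= => zI; rewrite integral_latitude_kernel.
apply: measurable_funTS.
apply: (@measurable_fun_fubini_tonelli_F _ _ _ _ R lebesgue_measure
  (fun x : R * R => (g x.2 * latitude_kernel c s x.1 x.2)%:E)).
- apply/measurable_EFinP; apply: measurable_funM => //.
  by apply: (measurableT_comp mg).
- by move=> x; rewrite lee_fin mulr_ge0// latitude_kernel_ge0.
Qed.

Lemma integral_circle (R : realType) (a b t0 : R) (g : R -> R) :
  continuous g -> (forall u, 0 <= g u) -> 0 <= t0 <= 2 * pi ->
  (\int[mu]_(t in [set` `[- pi, pi]%R]) (g (affine_cos a b (t - t0)%R))%:E =
   2%:E * \int[mu]_(t in `]0%R, pi[) (g (affine_cos a b t))%:E)%E.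
Proof.
move=> cg g0 t0I.
have cG : continuous (g \o affine_cos a b).
  by move=> t; apply: continuous_comp; [exact: continuous_affine_cos|exact: cg].
have G0 x : 0 <= (g \o affine_cos a b) x by exact: g0.
rewrite (@integral_periodic_shift _ t0 (g \o affine_cos a b))//; last first.
  by move=> x; rewrite /= /affine_cos -[2]/(1 *+ 2) mulrnAl mul1r cosD2pi.
rewrite (@integral_even _ pi (g \o affine_cos a b)) ?pi_ge0//; last first.
  by move=> x; rewrite /= /affine_cos cosN.
by rewrite integral_itv_bndoo//; exact: (continuous_measurable_EFin cG).
Qed.

Lemma integral_itvN1_opp (R : realType) (g : R -> R) : continuous g ->
  (\int[mu]_(z in [set` `](-1), 1[%R]) (g (- z)%R)%:E =
   \int[mu]_(z in [set` `](-1), 1[%R]) (g z)%:E)%E.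
Proof.
move=> cg; have cg' : continuous (g \o -%R).
  by move=> z; apply: continuous_comp; [exact: oppr_continuous|exact: cg].
rewrite -!(@integral_itv_bndoo _ _ _ _ true false); last 2 first.
  exact: continuous_measurable_EFin.
  exact: (continuous_measurable_EFin cg').
have N11 : -1 <= 1 :> R by rewrite (le_trans (y := 0))// lerN10.
have := integration_by_substitution_oppr N11 (G := g).
rewrite opprK => -> //; exact: continuous_subspaceT.
Qed.

(** When s = 0 the kernel degenerates; then c is 1 or -1 and the inner integrand
    does not depend on t. *)
Lemma funk_hecke_upper (R : realType) (c s : R) (g : R -> R) :
  c ^+ 2 + s ^+ 2 = 1 -> 0 <= s -> continuous g -> (forall u, 0 <= g u) ->
  (\int[mu]_(z in [set` `[(-1), 1]%R])
    \int[mu]_(t in `]0%R, pi[)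
      (g (affine_cos (c * z) (s * Num.sqrt (1 - z ^+ 2)) t))%:E =
   pi%:E * \int[mu]_(u in [set` `[(-1), 1]%R]) (g u)%:E)%E.
Proof.
move=> cs s0 cg g0; rewrite [in RHS]integral_itv_bndoo; last first.
  exact: continuous_measurable_EFin.
move: s0 cs; rewrite le_eqVlt => /predU1P[<-|s0] cs; last first.
  rewrite [LHS](@integral_itv_bndoo _ _ _ _ true false).
    exact: funk_hecke_open.
  exact: measurable_latitude_integral.
have cgc : continuous (fun z => g (c * z)).
  by move=> z; apply: (@continuous_comp _ _ _ ( *%R c) g); [exact: mulrl_continuous|exact: cg].
under eq_integral => z _.
  under eq_integral => t _ do rewrite /affine_cos mul0r mul0r addr0.
  rewrite (integral_cst _ _ (g (c * z))%:E)//= lebesgue_measure_itv/= lte_fin.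
  rewrite pi_gt0 sube0 muleC. over.
rewrite ge0_integralZl//; last 3 first.
- exact: (continuous_measurable_EFin cgc).
- by move=> z _; rewrite lee_fin.
- by rewrite lee_fin pi_ge0.
congr (_ * _)%E; rewrite [LHS](@integral_itv_bndoo _ _ _ _ true false); last first.
  exact: (continuous_measurable_EFin cgc).
have : (c == 1) || (c == -1).
  by rewrite -sqrf_eq1 -cs expr0n/= addr0.
case/orP => /eqP ->; first by under eq_integral => z _ do rewrite mul1r.
under eq_integral => z _ do rewrite mulN1r.
exact: integral_itvN1_opp.
Qed.

(** The argument of g is the cosine of the angle between the point of cylindrical
    coordinates (z, t) and the point of longitude t0 whose angle to the pole has
    cosine c and sine s.  As t runs over a full period, t0 can be removed, and
    parity reduces t to [0, pi]. *)
Lemma funk_hecke (R : realType) (c s t0 : R) (g : R -> R) :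
  c ^+ 2 + s ^+ 2 = 1 -> 0 <= s -> 0 <= t0 <= 2 * pi ->
  continuous g -> (forall u, 0 <= g u) ->
  (\int[mu]_(z in [set` `[(-1), 1]%R]) \int[mu]_(t in [set` `[- pi, pi]%R])
      (g (affine_cos (c * z) (s * Num.sqrt (1 - z ^+ 2)) (t - t0)%R))%:E =
   (2 * pi)%:E * \int[mu]_(u in [set` `[(-1), 1]%R]) (g u)%:E)%E.
Proof.
move=> cs s0 t0I cg g0.
have cg2 : continuous (fun u => 2 * g u) by move=> u; apply: cvgMr; exact: cg.
have g2 u : 0 <= 2 * g u by rewrite mulr_ge0.
have := funk_hecke_upper cs s0 cg2 g2.
under [X in _ = (_ * X)%E -> _]eq_integral => u _ do rewrite EFinM.
rewrite ge0_integralZl//; last 2 first.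
- exact: continuous_measurable_EFin.
- by move=> u _; rewrite lee_fin.
rewrite muleA -EFinM (mulrC pi) => <-; apply: eq_integral => z _.
rewrite integral_circle// -ge0_integralZl//.
- apply: (@continuous_measurable_EFin _ _ (g \o _)) => t.
  by apply: continuous_comp; [exact: continuous_affine_cos|exact: cg].
- by move=> t _; rewrite lee_fin.
Qed.

(** * Cylindrical coordinates on the sphere *)

(** An open set is the countable union of the rational rectangles that it
    contains. *)
Lemma open_measurable_prod (R : realType) (U : set (R * R)) :
  open U -> measurable (U : set (measurableTypeR R * measurableTypeR R)).
Proof.
move=> oU.
pose I (a b : rat) : set R := `]ratr a, ratr b[%classic.
pose E a b c d : set (R * R) :=
  if `[< I a b `*` I c d `<=` U >] then I a b `*` I c d else set0.
rewrite (_ : U = \bigcup_a \bigcup_b \bigcup_c \bigcup_d E a b c d).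
  do 4 (apply: bigcupT_measurable_rat => ?).
  by rewrite /E; case: ifPn => // _; apply: measurableX; apply: measurable_itv.
apply/seteqP; split => [[x y] Uxy|xy].
  have : nbhs (x, y) U by apply: open_nbhs_nbhs.
  rewrite -nbhs_ballE => -[e /= e0 eU].
  have [a] : exists q : rat, ratr q \in `]x - e, x[%R by apply: rat_in_itvoo; rewrite ltrBlDr ltrDl.
  have [b] : exists q : rat, ratr q \in `]x, x + e[%R by apply: rat_in_itvoo; rewrite ltrDl.
  have [c] : exists q : rat, ratr q \in `]y - e, y[%R by apply: rat_in_itvoo; rewrite ltrBlDr ltrDl.
  have [d] : exists q : rat, ratr q \in `]y, y + e[%R by apply: rat_in_itvoo; rewrite ltrDl.
  rewrite !in_itv/= => /andP[d1 d2] /andP[c1 c2] /andP[b1 b2] /andP[a1 a2].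
  exists a => //; exists b => //; exists c => //; exists d => //.
  rewrite /E; case: ifPn => [_|/asboolP].
    by split; rewrite /I /= in_itv/= ?a2 ?b1 ?c2 ?d1.
  case => -[u v] [/= ]; rewrite /I /= !in_itv/= => /andP[u1 u2] /andP[v1 v2].
  by apply: eU; split; rewrite /ball/= ltr_norml; apply/andP; split; lra.
move=> [a _ [b _ [c _ [d _]]]]; rewrite /E; case: ifPn => // /asboolP sU.
exact: sU.
Qed.

Definition vec3 (R : realType) (a b c : R) : 'rV[R]_3 :=
  \row_(i < 3) [:: a; b; c]`_i.

Lemma sum3 (R : realType) (F : 'I_3 -> R) :
  \sum_(i < 3) F i = F 0 + F 1 + F 2%:R.
Proof.
rewrite !big_ord_recl big_ord0 addr0 addrA; congr (_ + F _ + F _); exact: val_inj.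
Qed.

Lemma vec3E (R : realType) (a b c : R) :
  [/\ vec3 a b c 0 0 = a, vec3 a b c 0 1 = b & vec3 a b c 0 2%:R = c].
Proof. by split; rewrite mxE. Qed.

(** The retraction of the line onto [-1, 1]: it makes the cylindrical chart and
    the arc cosine total and continuous. *)
Definition clip (R : realType) (z : R) : R := Num.max (-1) (Num.min 1 z).

Lemma clip_itv (R : realType) (z : R) : -1 <= clip z <= 1.
Proof.
have N11 : -1 <= 1 :> R by rewrite (le_trans (lerN10 _)).
by rewrite /clip le_max lexx/= ge_max N11 ge_min lexx.
Qed.

Lemma clip_id (R : realType) (z : R) : -1 <= z <= 1 -> clip z = z.
Proof.
by move=> /andP[z1 z2]; rewrite /clip min_r// max_r.
Qed.

Lemma continuous_clip (R : realType) : continuous (@clip R).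
Proof.
move=> z; apply: (@continuous_max R R (cst (-1))); first exact: cst_continuous.
by apply: (@continuous_min R R (cst 1) id); [exact: cst_continuous|exact: cvg_id].
Qed.

Definition dot3 (R : realType) (u v : 'rV[R]_3) : R := \sum_(i < 3) u 0 i * v 0 i.

Lemma dot3E (R : realType) (u v : 'rV[R]_3) :
  dot3 u v = u 0 0 * v 0 0 + u 0 1 * v 0 1 + u 0 2%:R * v 0 2%:R.
Proof. by rewrite /dot3 sum3. Qed.

Section cylinder.
Context {R : realType}.

Definition parallel_radius (z : R) : R := Num.sqrt (1 - clip z ^+ 2).

Lemma parallel_radius_sqr (z : R) : clip z ^+ 2 + parallel_radius z ^+ 2 = 1.
Proof.
rewrite /parallel_radius sqr_sqrtr ?subrKC//.
by have /andP[? ?] := clip_itv z; rewrite subr_ge0; nra.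
Qed.

Lemma continuous_circle_radius : continuous parallel_radius.
Proof.
move=> z; apply: (@continuous_comp _ _ _ (fun z => 1 - clip z ^+ 2) Num.sqrt); last first.
  exact: sqrt_continuous.
apply: cvgB; first exact: cvg_cst.
apply: (@continuous_comp _ _ _ (@clip R) (fun x => x ^+ 2)); last exact: exprn_continuous.
exact: continuous_clip.
Qed.

Variable r : R.

Definition cylinder_point (x : R * R) : 'rV[R]_3 :=
  vec3 (r * clip x.1) (r * (parallel_radius x.1 * cos x.2))
    (r * (parallel_radius x.1 * sin x.2)).

Lemma cylinder_point_sphere x :
  \sum_(i < 3) cylinder_point x 0 i ^+ 2 == r ^+ 2.
Proof.
rewrite sum3; case: (vec3E (r * clip x.1) (r * (parallel_radius x.1 * cos x.2))
    (r * (parallel_radius x.1 * sin x.2))) => -> -> ->.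
apply/eqP; rewrite -[RHS]mulr1 -(parallel_radius_sqr x.1).
rewrite -[in RHS](mulr1 (parallel_radius _ ^+ 2)) -(cos2Dsin2 x.2); ring.
Qed.

Definition cylinder (x : R * R) : sphere r :=
  exist _ (cylinder_point x) (cylinder_point_sphere x).

(** The cosine of the angle at the centre between two points. *)
Definition cosang (p q : sphere r) : R :=
  dot3 (sval p) (sval q) / r ^+ 2.

End cylinder.

Lemma polar_coordinates (R : realType) (p q : R) :
  exists rho t, [/\ 0 <= rho, 0 <= t <= 2 * pi, p = rho * cos t & q = rho * sin t].
Proof.
have pi0 := pi_gt0 R.
pose rho := Num.sqrt (p ^+ 2 + q ^+ 2).
have pq0 : 0 <= p ^+ 2 + q ^+ 2 by rewrite addr_ge0// sqr_ge0.
have rho2 : rho ^+ 2 = p ^+ 2 + q ^+ 2 by rewrite sqr_sqrtr.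
have : 0 <= rho by rewrite sqrtr_ge0.
rewrite le_eqVlt => /predU1P[rho0|rho0].
  have : p ^+ 2 + q ^+ 2 = 0 by rewrite -rho2 -rho0 expr0n.
  move=> /eqP; rewrite paddr_eq0 ?sqr_ge0// !sqrf_eq0 => /andP[/eqP -> /eqP ->].
  exists 0, 0; rewrite !mul0r; split => //; lra.
pose u := p / rho.
have uI : -1 <= u <= 1.
  rewrite -ler_norml -(@expr_le1 _ 2)// -normrX ger0_norm ?sqr_ge0//.
  by rewrite expr_div_n ler_pdivrMr ?exprn_gt0// mul1r rho2 lerDl sqr_ge0.
have pE : p = rho * u by rewrite mulrC divfK// gt_eqF.
have qE : rho * Num.sqrt (1 - u ^+ 2) = `|q|.
  rewrite -sqrtr_sqr -[X in X * _ = _](ger0_norm (ltW rho0)) -sqrtr_sqr.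
  rewrite -sqrtrM ?sqr_ge0//; congr Num.sqrt.
  by rewrite mulrBr mulr1 -exprMn -pE rho2; ring.
have a0 := acos_ge0 uI; have api := acos_lepi uI.
have cu : cos (acos u) = u by rewrite acosK.
have su := sin_acos uI.
have [q0|q0] := leP 0 q.
  exists rho, (acos u); split; [exact: ltW| |by rewrite cu|].
    by rewrite a0/=; lra.
  by rewrite su qE ger0_norm.
exists rho, (2 * pi - acos u); split; [exact: ltW| | |].
- by apply/andP; split; lra.
- by rewrite (_ : 2 * pi = pi *+ 2) ?mulr_natl// addrC cosD2pi cosN cu.
- rewrite (_ : 2 * pi = pi *+ 2) ?mulr_natl// addrC sinD2pi sinN su mulrN qE.
  by rewrite ltr0_norm// opprK.
Qed.

Section cosang_cylinder.
Context {R : realType} {r : R}.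
Hypothesis r0 : 0 < r.

Lemma cosangC (p q : sphere r) : cosang p q = cosang q p.
Proof. by rewrite /cosang /dot3; under eq_bigr do rewrite mulrC. Qed.

Lemma cosang_refl (p : sphere r) : cosang p p = 1.
Proof.
case: p => p hp; rewrite /cosang/dot3/=; under eq_bigr do rewrite -expr2.
by rewrite (eqP hp) divff// expf_neq0// gt_eqF.
Qed.

Lemma sphere_polar (p : sphere r) : exists c s t,
  [/\ c ^+ 2 + s ^+ 2 = 1, 0 <= s, 0 <= t <= 2 * pi &
      sval p = vec3 (r * c) (r * (s * cos t)) (r * (s * sin t))].
Proof.
case: p => p hp /=.
have [rho [t [rho0 tI p1 p2]]] := polar_coordinates (p 0 1) (p 0 2%:R).
have rn0 : r != 0 by rewrite gt_eqF.
exists (p 0 0 / r), (rho / r), t; split => //.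
- apply: (@mulIf _ (r ^+ 2)); first by rewrite expf_neq0.
  rewrite mulrDl !expr_div_n !divfK ?expf_neq0// mul1r -(eqP hp) sum3 p1 p2.
  by rewrite !exprMn -addrA -mulrDr cos2Dsin2 mulr1.
- by rewrite divr_ge0// ltW.
- have [h0 h1 h2] := vec3E (r * (p 0 0 / r)) (r * (rho / r * cos t)) (r * (rho / r * sin t)).
  apply/rowP => i; case: i => [[|[|[|//]]]] hi.
  + rewrite (_ : Ordinal hi = 0); last exact: val_inj.
    by rewrite h0 mulrC divfK.
  + rewrite (_ : Ordinal hi = 1); last exact: val_inj.
    by rewrite h1 p1 mulrA [r * _]mulrC divfK.
  + rewrite (_ : Ordinal hi = 2%:R); last exact: val_inj.
    by rewrite h2 p2 mulrA [r * _]mulrC divfK.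
Qed.

Lemma cosang_cylinder (x : R * R) (q : sphere r) (c s t : R) :
  sval q = vec3 (r * c) (r * (s * cos t)) (r * (s * sin t)) ->
  cosang (cylinder r x) q =
  affine_cos (c * clip x.1) (s * parallel_radius x.1) (x.2 - t).
Proof.
move=> qE; rewrite /cosang dot3E qE /=.
have [-> -> ->] := vec3E (r * c) (r * (s * cos t)) (r * (s * sin t)).
have [-> -> ->] := vec3E (r * clip x.1) (r * (parallel_radius x.1 * cos x.2))
    (r * (parallel_radius x.1 * sin x.2)).
rewrite /affine_cos cosB; field.
by rewrite gt_eqF.
Qed.

Lemma continuous_cosang_cylinder (q : sphere r) :
  continuous (fun x => cosang (cylinder r x) q).
Proof.
have [c [s [t [_ _ _ qE]]]] := sphere_polar q.
rewrite (_ : (fun _ => _) = fun x : R * R => c * clip x.1 + 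
   (s * parallel_radius x.1) * cos (x.2 - t)); last first.
  by apply/funext => x; rewrite (cosang_cylinder x qE).
have c1 (f : R -> R) : continuous f -> continuous (f \o (@fst R R)).
  by move=> cf x; apply: continuous_comp; [exact: cvg_fst|exact: cf].
have c2 (f : R -> R) : continuous f -> continuous (f \o (@snd R R)).
  by move=> cf x; apply: continuous_comp; [exact: cvg_snd|exact: cf].
move=> x; apply: cvgD.
  by apply: cvgMr; apply: (c1 _ (@continuous_clip R)).
apply: cvgM.
  by apply: cvgMr; apply: (c1 _ (@continuous_circle_radius R)).
apply: (c2 (fun y => cos (y - t))) => y.
apply: (@continuous_comp _ _ _ (fun y => y - t) cos); last exact: continuous_cos.
by apply: cvgB; [exact: cvg_id|exact: cvg_cst].
Qed.

End cosang_cylinder.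

Section cylinder_measurable.
Context {R : realType} {r : R}.
Hypothesis r0 : 0 < r.
Variables (dist : sphere r -> sphere r -> R) (h : R -> R).
Hypothesis distE : forall p q, dist p q = h (cosang p q).
Hypothesis ch : continuous h.
Hypothesis h1 : h 1 = 0.

(** The preimage of an open set is open, because the distance from the image of
    a fixed point is continuous along the chart and vanishes at that point. *)
Lemma measurable_cylinder :
  measurable_fun setT (cylinder r : measurableTypeR R * measurableTypeR R -> borel dist).
Proof.
apply: (measurability (metric_open dist : set (set (borel dist)))) => // _ [U oU <-].
rewrite setTI; apply: open_measurable_prod.
rewrite openE => x /= Ux; have [e e0 eU] := oU _ Ux.
have cf : {for x, continuous (fun y => h (cosang (cylinder r y) (cylinder r x)))}.
  by apply: (@continuous_comp _ _ _ (fun y => cosang (cylinder r y) (cylinder r x)) h);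
   [exact: continuous_cosang_cylinder|exact: ch].
have : \forall y \near x, h (cosang (cylinder r y) (cylinder r x)) < e.
  by apply: (cvgr_lt _ cf); rewrite /= cosang_refl// h1.
by apply: filterS => y; rewrite cosangC -distE => /eU.
Qed.

End cylinder_measurable.

(** * Weight measures of distances that depend on the angle *)

Section chart_law.
Context {R : realType}.

Let ltN11 : -1 < 1 :> R.
Proof. by rewrite (lt_trans (ltrN10 _)). Qed.

Let ltNpipi : - pi < pi :> R.
Proof. by have := pi_gt0 R; lra. Qed.

(** By the theorem of Archimedes, the law of the cylindrical coordinates of a
    uniform random point of the sphere. *)
Definition chart_law : set (measurableTypeR R * measurableTypeR R) -> \bar R :=
  (uniform_prob ltN11 \x uniform_prob ltNpipi)%E.

HB.instance Definition _ := Measure.on chart_law.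

Let chart_lawT : chart_law setT = 1%E.
Proof.
rewrite /chart_law -setXTT product_measure1E// -[RHS]mule1.
by congr (_ * _)%E; apply: probability_setT.
Qed.

HB.instance Definition _ := Measure_isProbability.Build _ _ _ chart_law chart_lawT.

Lemma integral_chart_law (f : R * R -> R) :
  measurable_fun (setT : set (measurableTypeR R * measurableTypeR R)) f ->
  (forall x, 0 <= f x) ->
  (\int[chart_law]_x (f x)%:E = (4 * pi)^-1%:E *
    \int[mu]_(z in [set` `[(-1), 1]%R]) \int[mu]_(t in [set` `[- pi, pi]%R])
      (f (z, t))%:E)%E.
Proof.
move=> mf f0.
have mEf : measurable_fun (setT : set (measurableTypeR R * measurableTypeR R)) (EFin \o f).
  exact/measurable_EFinP.
have Ef0 x : (0 <= (EFin \o f) x)%E by rewrite lee_fin.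
rewrite (fubini_tonelli1 (m1 := uniform_prob ltN11) (m2 := uniform_prob ltNpipi) _ mEf)//.
rewrite integral_uniform; last 2 first.
- exact: (measurable_fun_fubini_tonelli_F (m2 := uniform_prob ltNpipi) _ mEf).
- by move=> z; apply: integral_ge0.
have mf1 z : measurable_fun setT (fun t => (f (z, t))%:E).
  exact: (measurableT_comp mEf (measurable_pair1 z)).
have inner z : (\int[uniform_prob ltNpipi]_t (f (z, t))%:E = (2 * pi)^-1%:E *
    \int[mu]_(t in [set` `[- pi, pi]%R]) (f (z, t))%:E)%E.
  rewrite (integral_uniform ltNpipi (mf1 z)); first by rewrite opprK -mulr2n mulr_natl.
  by move=> t; rewrite lee_fin.
have pi20 : 0 < 2 * pi :> R by rewrite mulr_gt0// pi_gt0.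
rewrite /fubini_F /=.
under eq_integral => z _ do rewrite inner.
rewrite ge0_integralZl//; last 3 first.
- have mi := measurable_fun_fubini_tonelli_F (m2 := uniform_prob ltNpipi) _ mEf Ef0.
  have : measurable_fun setT (fun z => (2 * pi)%:E * fubini_F (uniform_prob ltNpipi) (EFin \o f) z)%E.
    by apply: measurable_funeM.
  move=> mi2; apply: measurable_funTS; move: mi2.
  apply: eq_measurable_fun => z _; rewrite /fubini_F /= inner muleA -EFinM.
  by rewrite divff ?gt_eqF// mul1e.
- by move=> z _; apply: integral_ge0 => t _; rewrite lee_fin.
- by rewrite lee_fin invr_ge0 ltW.
rewrite muleA -EFinM -invfM; congr ((_^-1)%:E * _)%E; ring.
Qed.

End chart_law.

Section expdist.
Context {R : realType} {r : R}.
Hypothesis r0 : 0 < r.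
Variables (dist : sphere r -> sphere r -> R) (h : R -> R).
Hypothesis distE : forall p q, dist p q = h (cosang p q).
Hypothesis ch : continuous h.
Hypothesis edist_le : forall p q, edist (sval p) (sval q) <= dist p q.

Lemma coord_edist n (p q : 'rV[R]_n) i : `|p 0 i - q 0 i| <= edist p q.
Proof.
rewrite -sqrtr_sqr ler_wsqrtr// (bigD1 i)//= lerDl sumr_ge0// => j _.
exact: sqr_ge0.
Qed.

(** A distance that dominates the Euclidean one has at least the Euclidean open
    sets, so that coordinates are Borel for it. *)
Lemma measurable_coord i :
  measurable_fun setT (fun p : borel dist => sval (p : sphere r) 0 i).
Proof.
move=> mT; apply: (measurability _ (RGenOInfty.measurableE R)) => // _ [_ [a ->] <-].
rewrite setTI; apply: sub_sigma_algebra => p /=; rewrite in_itv/= andbT => ap.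
exists (sval p 0 i - a); first by rewrite subr_gt0.
move=> q pq; rewrite /= in_itv/= andbT.
have := le_lt_trans (le_trans (coord_edist (sval p) (sval q) i) (edist_le p q)) pq.
by rewrite ltr_norml => /andP[_]; lra.
Qed.

Lemma measurable_expdist : measurable_fun setT
  (fun x : borel dist * borel dist => expR (- dist x.1 x.2)).
Proof.
have m1 i : measurable_fun setT (fun x : borel dist * borel dist =>
    sval (x.1 : sphere r) 0 i) by apply: (measurableT_comp (measurable_coord i)).
have m2 i : measurable_fun setT (fun x : borel dist * borel dist =>
    sval (x.2 : sphere r) 0 i) by apply: (measurableT_comp (measurable_coord i)).
have mh : measurable_fun setT h by exact: continuous_measurable_fun.
apply: measurableT_comp; first exact: measurable_expR.
rewrite (_ : (fun _ => _) = fun x => - h (cosang (x.1 : sphere r) (x.2 : sphere r))); last first.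
  by apply/funext => x; rewrite distE.
apply: measurable_funN; apply: (measurableT_comp mh).
rewrite /cosang /dot3; apply: measurable_funM; last exact: measurable_cst.
by apply: measurable_sum => i; apply: measurable_funM.
Qed.

End expdist.

(** Whatever Hahn decomposition is chosen, the negative set of a measure is
    null. *)
Lemma charge_integral_measure d (T : measurableType d) (R : realType)
    (m : {finite_measure set T -> \bar R}) (f : T -> \bar R) :
  charge_integral (charge_of_finite_measure m) f = (\int[m]_x f x)%E.
Proof.
rewrite /charge_integral.
set P := cid _; set N := cid _; case: N => N PN /=.
have [[mP posP] [mN negN] PNT PN0] := PN.
have m0 A : measurable A -> m (A `&` N) = 0%E.
  move=> mA; apply/eqP; rewrite eq_le measure_ge0 andbT.
  by apply: (negN (A `&` N)) => //; exact: measurableI.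
have posE A : measurable A -> jordan_pos PN A = m A.
  move=> mA; rewrite jordan_posE cjordan_posE /crestr0 mem_set// /crestr/=.
  rewrite /charge_of_finite_measure.
  rewrite -[in RHS](setIT A) -PNT setIUr measureU.
  - by rewrite -[LHS]adde0; congr (_ + _)%E; exact/esym/m0.
  - exact: measurableI.
  - exact: measurableI.
  - by rewrite setIACA PN0 setI0.
have negE A : measurable A -> jordan_neg PN A = mzero A.
  move=> mA; rewrite jordan_negE cjordan_negE /crestr0 mem_set// /crestr/=.
  by rewrite /charge_of_finite_measure m0// oppe0.
rewrite (@eq_measure_integral _ _ _ setT m); last by move=> A mA _; exact: posE.
rewrite [X in (_ - X)%E](@eq_measure_integral _ _ _ setT mzero); last by move=> A mA _; exact: negE.
by rewrite integral_measure_zero sube0.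
Qed.

Section weight.
Context {R : realType} {r : R}.
Hypothesis r0 : 0 < r.
Variables (dist : sphere r -> sphere r -> R) (h : R -> R).
Hypothesis distE : forall p q, dist p q = h (cosang p q).
Hypothesis ch : continuous h.
Hypothesis h1 : h 1 = 0.
Hypothesis edist_le : forall p q, edist (sval p) (sval q) <= dist p q.
Variable J : R.
Hypothesis J0 : 0 < J.
Hypothesis hJ : (\int[mu]_(u in [set` `[(-1), 1]%R]) (expR (- h u))%:E)%E = J%:E.

Let cylinderM : {mfun (measurableTypeR R * measurableTypeR R)%type >-> borel dist} :=
  mfun_Sub (mem_set (measurable_cylinder r0 distE ch h1)).

Let k : {nonneg R} := NngNum (divr_ge0 (ler0n R 2) (ltW J0)).

(** The uniform measure normalised to have potential 1. *)
Definition uniform_weight : {finite_measure set (borel dist) -> \bar R} :=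
  mscale k (distribution chart_law cylinderM).

Lemma uniform_weightT : uniform_weight setT = (2 / J)%:E.
Proof.
rewrite -[LHS]/(k%:num%:E * distribution chart_law cylinderM setT)%E.
by rewrite [X in (_ * X)%E]probability_setT mule1.
Qed.

Lemma uniform_weight_potential (y : sphere r) :
  (\int[uniform_weight]_x (expR (- dist x y))%:E = 1)%E.
Proof.
have me' : measurable_fun setT (fun x : borel dist => expR (- dist x y)).
  exact: (measurableT_comp (measurable_expdist distE ch edist_le) (measurable_pair2 (y : borel dist))).
have me : measurable_fun setT (fun x : borel dist => (expR (- dist x y))%:E).
  exact/measurable_EFinP.
rewrite ge0_integral_mscale//.
rewrite ge0_integral_distribution//.
have [c [s [t [cs s0 tI yE]]]] := sphere_polar r0 y.
rewrite integral_chart_law; last 2 first.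
- apply: (measurableT_comp me'); exact: measurable_funPT.
- by move=> x; exact: expR_ge0.
pose g u := expR (- h u).
have cg : continuous g.
  move=> u; apply: (@continuous_comp _ _ _ (fun u => - h u) expR); last exact: continuous_expR.
  by apply: cvgN; exact: ch.
have g0 u : 0 <= g u by exact: expR_ge0.
have -> : (\int[mu]_(z in [set` `[(-1), 1]%R]) \int[mu]_(t in [set` `[- pi, pi]%R])
      (expR (- dist (cylinderM (z, t)) y))%:E = (2 * pi)%:E * J%:E)%E.
  rewrite -hJ -(funk_hecke cs s0 tI cg g0); apply: eq_integral => z.
  rewrite inE/= in_itv/= => zI; apply: eq_integral => u _; congr (_%:E).
  rewrite /g distE (cosang_cylinder r0 _ yE)/=.
  by rewrite /parallel_radius clip_id.
rewrite -!EFinM; congr (_%:E) => /=.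
move: (pi_gt0 R); move: (pi : R) => w w0; field.
by rewrite (gt_eqF J0) (gt_eqF w0).
Qed.

Lemma weight_measure_uniform :
  weight_measure (dist := dist) (charge_of_finite_measure uniform_weight).
Proof.
by move=> y; rewrite charge_integral_measure; exact: uniform_weight_potential.
Qed.

(** Tonelli and the symmetry of the kernel: the uniform weight integrates the
    potential of m to the integral of 1 against m. *)
Lemma integral_potential (m : {finite_measure set (borel dist) -> \bar R}) :
  (\int[uniform_weight]_y \int[m]_x (expR (- dist x y))%:E = m setT)%E.
Proof.
rewrite (fubini_tonelli (m1 := uniform_weight) (m2 := m)
  (fun z : borel dist * borel dist => (expR (- dist z.2 z.1))%:E)); last 2 first.
- apply/measurable_EFinP.
  rewrite (_ : (fun _ => _) = fun z : borel dist * borel dist => expR (- dist z.1 z.2)).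
    exact: measurable_expdist.
  by apply/funext => z; rewrite !distE cosangC.
- by move=> z; rewrite lee_fin expR_ge0.
under eq_integral => x _.
  under eq_integral => y _ do rewrite distE cosangC -distE.
  rewrite uniform_weight_potential; over.
by rewrite integral_cst// mul1e.
Qed.

(** The potentials of the two Jordan parts differ by 1; integrating this
    relation against the uniform weight compares the masses. *)
Lemma weight_measure_mass (nu : {charge set (borel dist) -> \bar R}) :
  weight_measure (dist := dist) nu -> nu setT = (2 / J)%:E.
Proof.
move=> wnu.
set P := cid (Hahn_decomposition nu); set N := cid (projT2 P).
pose mp : {finite_measure set (borel dist) -> \bar R} := jordan_pos (projT2 N).
pose mn : {finite_measure set (borel dist) -> \bar R} := jordan_neg (projT2 N).
have nuE : nu setT = (mp setT - mn setT)%E.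
  by rewrite (jordan_decomp (projT2 N))// /cadd /= /cscale EFinN mulN1e.
pose I (m : {finite_measure set (borel dist) -> \bar R}) (y : borel dist) : \bar R :=
  (\int[m]_x (expR (- dist x y))%:E)%E.
have I0 m y : (0 <= I m y)%E by apply: integral_ge0 => x _; rewrite lee_fin expR_ge0.
have mI m : measurable_fun (setT : set (borel dist)) (I m).
  apply: (measurable_fun_fubini_tonelli_G (m1 := m)
    (fun z : borel dist * borel dist => (expR (- dist z.1 z.2))%:E)).
  + by apply/measurable_EFinP; exact: measurable_expdist.
  + by move=> z; rewrite lee_fin expR_ge0.
have Ipn y : I mp y = (1 + I mn y)%E.
  have := wnu y; rewrite /charge_integral -/P -/N -/(I mp y) -/(I mn y) => Iy.
  have nfin : I mn y \is a fin_num.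
    rewrite ge0_fin_numE// (@le_lt_trans _ _ (mn setT))//; last first.
      by rewrite -ge0_fin_numE// fin_num_measure.
    rewrite -[leRHS]mul1e -integral_cst//; apply: ge0_le_integral => //.
    + apply/measurable_EFinP.
      exact: (measurableT_comp (measurable_expdist distE ch edist_le) (measurable_pair2 (y : borel dist))).
    + move=> x _; rewrite lee_fin -expR0 ler_expR oppr_le0.
      by rewrite (le_trans _ (edist_le _ _))// sqrtr_ge0.
  by rewrite -Iy subeK.
have : mp setT = (2 / J)%:E + mn setT.
  rewrite -(integral_potential mp) -(integral_potential mn) -uniform_weightT.
  rewrite -/(I mp) -/(I mn).
  under eq_integral => y _ do rewrite -/(I mp y) Ipn.
  rewrite ge0_integralD//=; first by rewrite integral_cst// mul1e.
rewrite nuE => ->; rewrite addeK// fin_num_measure//.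
Qed.

Theorem has_weight_measure_radial : has_weight_measure dist.
Proof.
by exists (charge_of_finite_measure uniform_weight); exact: weight_measure_uniform.
Qed.

Theorem magnitude_radial : magnitude dist = 2 / J.
Proof.
rewrite /magnitude; apply: xget_unique.
  exists (charge_of_finite_measure uniform_weight).
    exact: weight_measure_uniform.
  exact: uniform_weightT.
by move=> m [nu wnu num]; apply: EFin_inj; rewrite -num weight_measure_mass.
Qed.

End weight.

(** * Chords and angles *)

Section angle.
Context {R : realType}.

Lemma acos_dec : {in `[-1, 1] &, {mono (@acos R) : x y /~ x <= y}}.
Proof.
move=> x y; rewrite !in_itv/= => xI yI.
have aI z : -1 <= z <= 1 -> acos z \in `[0, pi].
  by move=> zI; rewrite in_itv/= acos_ge0// acos_lepi.
rewrite [LHS]leNgt -ltr_cos ?aI// !acosK ?in_itv//=.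
by rewrite -leNgt.
Qed.

Lemma within_continuous_acos : {within `[-1, 1], continuous (@acos R)}.
Proof.
apply: segment_dec_surj_continuous; first exact: acos_dec.
rewrite acos1 acosN1 => a /= aI; exists (cos a); last by rewrite cosK.
by rewrite /= in_itv/= cos_geN1 cos_le1.
Qed.

(** The arc cosine is continuous up to the endpoints, where it is not
    differentiable, as a monotone surjection between intervals. *)
Lemma continuous_acos_clip : continuous (fun x : R => acos (clip x)).
Proof.
move=> x; have cI : `[-1, 1]%classic (clip x) by rewrite /= in_itv/= clip_itv.
move=> U xU; have /subspace_continuousP/(_ _ cI U xU) := within_continuous_acos.
move=> /(@continuous_clip R x) H.
apply: (@filterS _ (nbhs x) _ _ _ _ H) => y /=; apply.
by rewrite in_itv/= clip_itv.
Qed.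

Lemma sin_mvt (x : R) : 0 <= x -> exists2 y, 0 <= y <= x & sin x = x * cos y.
Proof.
move=> x0.
have [y] := @MVT_segment R sin cos 0 x x0 (fun y _ => is_derive_sin y)
  (continuous_subspaceT (@continuous_sin R)).
by rewrite in_itv/= sin0 !subr0 mulrC => yI ->; exists y.
Qed.

(** Mean value theorem, the cosine being decreasing. *)
Lemma sin_ge_mul_cos (x : R) : 0 <= x <= pi -> x * cos x <= sin x.
Proof.
move=> /andP[x0 xpi]; have [y /andP[y0 yx] ->] := sin_mvt x0.
rewrite ler_wpM2l// leNgt ltr_cos ?in_itv/= ?x0 ?y0 ?xpi ?(le_trans yx)//.
by rewrite -leNgt.
Qed.

Lemma chord_sqr (x : R) : 2 - 2 * cos x = (2 * sin (x / 2)) ^+ 2.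
Proof.
rewrite {1}(_ : x = (x / 2) *+ 2); last by rewrite -mulr_natr divfK.
by rewrite cos_mulr2n exprMn sin2cos2; ring.
Qed.

Lemma chord_le_arc (x : R) : 0 <= x -> Num.sqrt (2 - 2 * cos x) <= x.
Proof.
move=> x0; rewrite chord_sqr sqrtr_sqr normrM ger0_norm//.
have x20 : 0 <= x / 2 by rewrite divr_ge0.
have [y _ ->] := sin_mvt x20.
rewrite normrM (ger0_norm x20) mulrA [2 * _]mulrC divfK// ler_piMr// ler_norml.
by rewrite cos_geN1 cos_le1.
Qed.

Lemma chord_ge_arc (x c : R) : 0 <= x <= pi -> c <= cos x ->
  x * cos (x / 2) <= Num.sqrt (2 - 2 * c).
Proof.
move=> /andP[x0 xpi] cx.
apply: (@le_trans _ _ (Num.sqrt (2 - 2 * cos x))); last first.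
  by rewrite ler_wsqrtr// lerD2l lerN2 ler_wpM2l.
have x2 : 0 <= x / 2 <= pi by apply/andP; split; lra.
rewrite chord_sqr sqrtr_sqr (le_trans _ (ler_norm _))//.
by have := sin_ge_mul_cos x2; lra.
Qed.

End angle.

Section sphere_angle.
Context {R : realType} {r : R}.
Hypothesis r0 : 0 < r.
Implicit Types p q x y : sphere r.

Let r2 : r ^+ 2 != 0. Proof. by rewrite expf_neq0// gt_eqF. Qed.

Lemma cosangM p q : cosang p q * r ^+ 2 =
  sval p 0 0 * sval q 0 0 + sval p 0 1 * sval q 0 1 +
  sval p 0 2%:R * sval q 0 2%:R.
Proof. by rewrite /cosang divfK// dot3E. Qed.

Lemma sphereP p :
  sval p 0 0 ^+ 2 + sval p 0 1 ^+ 2 + sval p 0 2%:R ^+ 2 = r ^+ 2.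
Proof. by case: p => p /= /eqP; rewrite sum3. Qed.

Lemma edist_sphere p q :
  edist (sval p) (sval q) = r * Num.sqrt (2 - 2 * cosang p q).
Proof.
rewrite /edist sum3 -[X in X * _](ger0_norm (ltW r0)) -sqrtr_sqr.
rewrite -sqrtrM ?sqr_ge0//; congr Num.sqrt.
rewrite mulrBr [r ^+ 2 * (2 * _)](_ : _ = 2 * (cosang p q * r ^+ 2)); last by ring.
rewrite cosangM (_ : r ^+ 2 * 2 = r ^+ 2 + r ^+ 2); last by ring.
by have := sphereP p; have := sphereP q; lra.
Qed.

Lemma cosang_itv p q : -1 <= cosang p q <= 1.
Proof.
have rr : 0 < r ^+ 2 by rewrite exprn_gt0.
have h := cosangM p q; have hp := sphereP p; have hq := sphereP q.
move: h hp hq; move: (sval p 0 0) (sval p 0 1) (sval p 0 2%:R).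
move: (sval q 0 0) (sval q 0 1) (sval q 0 2%:R) => q1 q2 q3 p1 p2 p3.
move=> h hp hq.
have d1 : 0 <= (p1 - q1) ^+ 2 + (p2 - q2) ^+ 2 + (p3 - q3) ^+ 2.
  by rewrite !addr_ge0 ?sqr_ge0.
have d2 : 0 <= (p1 + q1) ^+ 2 + (p2 + q2) ^+ 2 + (p3 + q3) ^+ 2.
  by rewrite !addr_ge0 ?sqr_ge0.
apply/andP; split; rewrite -(ler_pM2r rr) h; lra.
Qed.

(** The difference of the two sides is the Gram determinant of three unit
    vectors, the square of a 3 x 3 determinant. *)
Lemma cosang_gram x y p :
  (cosang x y - cosang p x * cosang p y) ^+ 2 <=
  (1 - cosang p x ^+ 2) * (1 - cosang p y ^+ 2).
Proof.
have h1 := cosangM x y; have h2 := cosangM p x; have h3 := cosangM p y.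
have hp := sphereP p; have hx := sphereP x; have hy := sphereP y.
move: h1 h2 h3 hp hx hy; move: (cosang x y) (cosang p x) (cosang p y) => c a b.
move: (sval p 0 0) (sval p 0 1) (sval p 0 2%:R).
move: (sval x 0 0) (sval x 0 1) (sval x 0 2%:R).
move: (sval y 0 0) (sval y 0 1) (sval y 0 2%:R).
move=> y1 y2 y3 x1 x2 x3 p1 p2 p3 h1 h2 h3 hp hx hy.
rewrite -subr_ge0 -(pmulr_rge0 _ (exprn_gt0 3 (exprn_gt0 2 r0))).
suff -> : (r ^+ 2) ^+ 3 * ((1 - a ^+ 2) * (1 - b ^+ 2) - (c - a * b) ^+ 2) =
  (p1 * (x2 * y3 - x3 * y2) - p2 * (x1 * y3 - x3 * y1)
   + p3 * (x1 * y2 - x2 * y1)) ^+ 2 by exact: sqr_ge0.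
transitivity (
  let P := p1 ^+ 2 + p2 ^+ 2 + p3 ^+ 2 in
  let X := x1 ^+ 2 + x2 ^+ 2 + x3 ^+ 2 in
  let Y := y1 ^+ 2 + y2 ^+ 2 + y3 ^+ 2 in
  let C := x1 * y1 + x2 * y2 + x3 * y3 in
  let A := p1 * x1 + p2 * x2 + p3 * x3 in
  let B := p1 * y1 + p2 * y2 + p3 * y3 in
  P * X * Y + 2 * C * A * B - P * C ^+ 2 - X * B ^+ 2 - Y * A ^+ 2); last first.
  by rewrite /=; ring.
by rewrite /= hp hx hy -h1 -h2 -h3; ring.
Qed.

Definition angle p q : R := acos (cosang p q).

Lemma angle_itv p q : 0 <= angle p q <= pi.
Proof. by rewrite acos_ge0 ?acos_lepi ?cosang_itv. Qed.

Lemma cos_angle p q : cos (angle p q) = cosang p q.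
Proof. by rewrite acosK// in_itv/= cosang_itv. Qed.

(** A form of the triangle inequality for angles: the angle between x and y is at
    least the difference of their angles to p. *)
Lemma cosang_le_cos_angleB x y p :
  cosang x y <= cos (angle p y - angle p x).
Proof.
rewrite cosB !cos_angle !sin_acos ?cosang_itv//.
rewrite -sqrtrM; last first.
  by have /andP[? ?] := cosang_itv p y; rewrite subr_ge0; nra.
rewrite -lerBlDl (le_trans (ler_norm _))// -sqrtr_sqr ler_wsqrtr//.
by have := cosang_gram x y p; rewrite [X in _ <= X]mulrC [cosang p x * _]mulrC.
Qed.

Lemma edist_ge_angleB x y p (d : R) : angle p y - angle p x = d -> 0 <= d ->
  r * (d * cos (d / 2)) <= edist (sval x) (sval y).
Proof.
move=> dE d0; rewrite edist_sphere ler_pM2l//; apply: chord_ge_arc.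
  have /andP[? ?] := angle_itv p y; have /andP[? ?] := angle_itv p x.
  by rewrite d0 -dE; lra.
by rewrite -dE cosang_le_cos_angleB.
Qed.

End sphere_angle.

(** * The geodesic distance *)

Section polyline.
Context {R : realType} {n : nat}.
Implicit Types (g : R -> 'rV[R]_n) (a b x : R) (s : seq R).

Definition polyline_length b a g s : R :=
  \sum_(0 <= k < size s) edist (g (nth b (a :: s) k)) (g (nth b (a :: s) k.+1)).

Lemma polyline_length_cons b a x g s :
  polyline_length b a g (x :: s) = edist (g a) (g x) + polyline_length b x g s.
Proof. by rewrite /polyline_length /= big_nat_recl. Qed.

Lemma edist_ge0 m (p q : 'rV[R]_m) : 0 <= edist p q.
Proof. exact: sqrtr_ge0. Qed.

Lemma polyline_length_ge0 b a g s : 0 <= polyline_length b a g s.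
Proof. by apply: sumr_ge0 => k _; exact: edist_ge0. Qed.

Lemma curve_length_ge a b g s : itv_partition a b s ->
  ((polyline_length b a g s)%:E <= curve_length a b g)%E.
Proof. by move=> ps; apply: ereal_sup_ubound; exists s. Qed.

Lemma curve_length_le_lipschitz a b g (L : R) :
  (forall x y, a <= x -> x <= y -> y <= b -> edist (g x) (g y) <= L * (y - x)) ->
  (curve_length a b g <= (L * (b - a))%:E)%E.
Proof.
move=> gL; apply: ge_ereal_sup => _ [s ps <-]; rewrite lee_fin.
rewrite -/(polyline_length b a g s).
have : forall x, a <= x -> itv_partition x b s -> polyline_length b x g s <= L * (b - x).
  move=> {ps}; elim: s => [|y s IH] x ax ps.
    by rewrite (itv_partition_nil ps) subrr mulr0 /polyline_length big_geq.
  have xy : x <= y by case: ps => /= /andP[/ltW].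
  have yb : y <= b by have := itv_partition_cons ps => /itv_partition_le.
  rewrite polyline_length_cons.
  have -> : L * (b - x) = L * (y - x) + L * (b - y) by ring.
  by rewrite lerD ?gL// IH ?(le_trans ax)//; exact: itv_partition_cons ps.
by apply.
Qed.

End polyline.

Lemma continuous_combination3 (R : realType) (T : topologicalType)
    (a b c d : R) (f g h : T -> R) :
  continuous f -> continuous g -> continuous h ->
  continuous (fun v => (a * f v + b * g v + c * h v) / d).
Proof.
move=> cf cg ch v; apply: cvgMl.
by apply: cvgD; [apply: cvgD|]; apply: cvgMr; [exact: cf|exact: cg|exact: ch].
Qed.

Section intrinsic.
Context {R : realType} {r : R}.
Hypothesis r0 : 0 < r.
Implicit Types p q x y : sphere r.

Lemma continuous_angle_path p q (g : R -> sphere r) : sphere_path p q g ->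
  {within `[0, 1], continuous (fun t => angle p (g t))}.
Proof.
move=> [cg _ _].
pose dot (v : 'rV[R]_3) := (sval p 0 0 * v 0 0 + sval p 0 1 * v 0 1 +
  sval p 0 2%:R * v 0 2%:R) / r ^+ 2.
have cdot : continuous dot.
  by apply: continuous_combination3 => v; exact: coord_continuous.
have cG : continuous ((fun x : R => acos (clip x)) \o dot).
  by move=> v; apply: continuous_comp; [exact: cdot|exact: continuous_acos_clip].
rewrite (_ : (fun t => angle p (g t)) =
    ((fun x : R => acos (clip x)) \o dot) \o (fun t => sval (g t))).
  by apply: within_continuous_comp cg => v _; exact: cG.
apply/funext => t; rewrite /angle /= -[X in acos X](clip_id (cosang_itv r0 _ _)).
by rewrite /cosang dot3E.
Qed.

(** Induction on the number m of steps that remain: the intermediate value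
    theorem on [t, 1] gives the next time at which the angle to p has grown by
    d, and the chord over this step is bounded below by the growth of the
    angle.  When no step remains, the endpoint 1 closes the partition. *)
Lemma polyline_length_ge_angle p q (g : R -> sphere r) (d : R) (m : nat) (t : R) :
  sphere_path p q g -> 0 <= d -> 0 <= t <= 1 ->
  angle p (g t) = angle p q - m%:R * d ->
  exists2 s, itv_partition t 1 s &
    m%:R * (r * (d * cos (d / 2))) <= polyline_length 1 t (fun t => sval (g t)) s.
Proof.
move=> pg; rewrite le_eqVlt => /predU1P[<-|d0].
  rewrite !mul0r mulr0 => /andP[t0]; rewrite le_eqVlt => /predU1P[->|t1] _.
    exists [::]; first by split => /=.
    by rewrite mulr0 polyline_length_ge0.
  exists [:: 1]; first exact: itv_partition1.
  by rewrite mulr0 polyline_length_ge0.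
elim: m t => [|m IH] t /andP[t0 t1] at_.
  move: t1; rewrite le_eqVlt => /predU1P[->|t1].
    exists [::]; first by split => /=.
    by rewrite mul0r polyline_length_ge0.
  exists [:: 1]; first exact: itv_partition1.
  by rewrite mul0r polyline_length_ge0.
have [_ _ g1] := pg.
have ca : {within `[t, 1], continuous (fun t => angle p (g t))}.
  apply: continuous_subspaceW (continuous_angle_path pg).
  by apply: subset_itv; rewrite bnd_simp.
have [] := @IVT R _ t 1 (angle p q - m%:R * d) t1 ca.
  rewrite g1 at_ ge_min le_max.
  have md : 0 <= m%:R * d by rewrite mulr_ge0// ltW.
  by apply/andP; split; apply/orP; [left; rewrite -natr1|right]; lra.
move=> c; rewrite in_itv/= => /andP[tc c1] ac.
have {}tc : t < c.
  rewrite lt_neqAle tc andbT; apply/eqP => tcE.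
  move: ac; rewrite -tcE at_ -natr1 => ?; lra.
have cI : 0 <= c <= 1 by rewrite c1 (le_trans t0)// ltW.
have [s ps hs] := IH c cI ac; exists (c :: s).
  by case: ps => ps1 ps2; split => //=; rewrite tc.
rewrite polyline_length_cons -natr1 mulrDl mul1r addrC lerD//.
apply: (edist_ge_angleB r0 (p := p)); last exact: ltW.
by rewrite ac at_ -natr1; ring.
Qed.

(** With n + 1 equal steps the bound is r A cos (A / (2 (n + 1))), which tends to
    r A. *)
Lemma curve_length_ge_angle p q (g : R -> sphere r) : sphere_path p q g ->
  ((r * angle p q)%:E <= curve_length 0 1 (fun t => sval (g t)))%E.
Proof.
move=> pg; have [_ g0 _] := pg.
set A := angle p q; set L := curve_length _ _ _.
have A0 : 0 <= A by have /andP[] := angle_itv r0 p q.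
have a0 : angle p (g 0) = 0 by rewrite /angle g0 cosang_refl// acos1.
have H (n : nat) : ((r * A * cos (A / n.+1%:R / 2))%:E <= L)%E.
  have [|||s ps hs] := polyline_length_ge_angle (m := n.+1) (t := 0) (d := A / n.+1%:R) pg.
  - by rewrite divr_ge0.
  - by rewrite lexx ler01.
  - by rewrite a0 mulrC divfK// subrr.
  apply: le_trans (curve_length_ge _ ps); rewrite lee_fin; apply: le_trans hs.
  rewrite le_eqVlt; apply/orP; left; apply/eqP.
  by move: (cos _) => w; field.
have Lny : L != -oo%E by apply/eqP => LE; have := H 0%N; rewrite LE leeNy_eq.
case: L H Lny => [l| |] // H _; last by rewrite leey.
rewrite lee_fin; have c0 : A / n.+1%:R / 2 @[n --> \oo] --> (0 : R).
  rewrite -[X in _ --> X](mul0r 2^-1); apply: cvgMl.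
  by rewrite -[X in _ --> X](mulr0 A); apply: cvgMr; exact: cvg_harmonic.
have cvgc : r * A * cos (A / n.+1%:R / 2) @[n --> \oo] --> r * A.
  rewrite -[X in _ --> X]mulr1; apply: cvgMr.
  have := cvg_comp _ _ c0 (@continuous_cos R 0).
  by rewrite cos0.
rewrite -(cvg_lim _ cvgc)//; apply: limr_le; first by apply/cvg_ex; exists (r * A).
by apply: nearW => n; rewrite -lee_fin.
Qed.

End intrinsic.

Section great_circle.
Context {R : realType} {r : R}.
Hypothesis r0 : 0 < r.
Implicit Types p q x y : sphere r.

Lemma dot3_sphere p : dot3 (sval p) (sval p) = r ^+ 2.
Proof. by rewrite dot3E -!expr2 sphereP. Qed.

Lemma dot3C (u v : 'rV[R]_3) : dot3 u v = dot3 v u.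
Proof. by rewrite !dot3E; ring. Qed.

Lemma dot3_comb (a b : R) (u v w : 'rV[R]_3) :
  dot3 (a *: u + b *: v) w = a * dot3 u w + b * dot3 v w.
Proof. by rewrite !dot3E !mxE; ring. Qed.

Lemma dot3_eq0 (u : 'rV[R]_3) : dot3 u u = 0 -> u = 0.
Proof.
move=> /eqP; rewrite dot3E -!expr2 !paddr_eq0 ?addr_ge0 ?sqr_ge0// !sqrf_eq0.
move=> /andP[/andP[/eqP u0 /eqP u1] /eqP u2].
apply/rowP => i; rewrite mxE; case: i => [[|[|[|//]]]] hi.
- by rewrite (_ : Ordinal hi = 0)//; exact: val_inj.
- by rewrite (_ : Ordinal hi = 1)//; exact: val_inj.
- by rewrite (_ : Ordinal hi = 2%:R)//; exact: val_inj.
Qed.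

Lemma cosang_dot3 p q : dot3 (sval p) (sval q) = cosang p q * r ^+ 2.
Proof. by rewrite cosangM// dot3E. Qed.

Lemma exists_perpendicular p : exists e : 'rV[R]_3,
  dot3 e e = r ^+ 2 /\ dot3 (sval p) e = 0.
Proof.
have [c [s [t [cs _ _ ->]]]] := sphere_polar r0 p.
exists (vec3 (r * (- s)) (r * (c * cos t)) (r * (c * sin t))).
rewrite !dot3E.
have [-> -> ->] := vec3E (r * c) (r * (s * cos t)) (r * (s * sin t)).
have [-> -> ->] := vec3E (r * (- s)) (r * (c * cos t)) (r * (c * sin t)).
have ct := cos2Dsin2 t; split.
  transitivity (r ^+ 2 * (s ^+ 2 + c ^+ 2 * (cos t ^+ 2 + sin t ^+ 2))); first by ring.
  by rewrite ct mulr1 addrC cs mulr1.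
transitivity (r ^+ 2 * c * s * (cos t ^+ 2 + sin t ^+ 2 - 1)); first by ring.
by rewrite ct subrr mulr0.
Qed.

(** The component of q orthogonal to p has norm r sin A, where A is the angle.
    When p and q are equal or antipodal it vanishes, and every vector orthogonal
    to p is a possible direction. *)
Lemma great_circle_tangent p q : exists e : 'rV[R]_3,
  [/\ dot3 e e = r ^+ 2, dot3 (sval p) e = 0 &
      sval q = cos (angle p q) *: sval p + sin (angle p q) *: e].
Proof.
set A := angle p q.
have cA : cos A = cosang p q by exact: cos_angle.
pose w := sval q - cos A *: sval p.
have wE : w = 1 *: sval q + (- cos A) *: sval p by rewrite scale1r scaleNr.
have pw : dot3 (sval p) w = 0.
  by rewrite dot3C wE dot3_comb dot3_sphere dot3C cosang_dot3 cA; ring.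
have ww : dot3 w w = sin A ^+ 2 * r ^+ 2.
  rewrite {1}wE dot3_comb pw mulr0 addr0 mul1r dot3C wE dot3_comb.
  by rewrite dot3_sphere cosang_dot3 -cA sin2cos2; ring.
have qE : sval q = cos A *: sval p + w by rewrite /w addrC subrK.
have [sA0|sA0] := eqVneq (sin A) 0.
  have w0 : w = 0 by apply: dot3_eq0; rewrite ww sA0 expr0n/= mul0r.
  have [e [e1 e2]] := exists_perpendicular p.
  by exists e; split => //; rewrite qE w0 sA0 scale0r.
exists ((sin A)^-1 *: w); split.
- have -> : (sin A)^-1 *: w = (sin A)^-1 *: w + 0 *: w by rewrite scale0r addr0.
  rewrite dot3_comb dot3C dot3_comb ww.
  by field.
- have -> : (sin A)^-1 *: w = (sin A)^-1 *: w + 0 *: w by rewrite scale0r addr0.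
  by rewrite dot3C dot3_comb dot3C pw; ring.
- by rewrite scalerA divff// scale1r.
Qed.

Definition great_circle (u e : 'rV[R]_3) (A t : R) : 'rV[R]_3 :=
  cos (t * A) *: u + sin (t * A) *: e.

Lemma dot3_great_circle (u e : 'rV[R]_3) A s t :
  dot3 u u = r ^+ 2 -> dot3 e e = r ^+ 2 -> dot3 u e = 0 ->
  dot3 (great_circle u e A s) (great_circle u e A t) = r ^+ 2 * cos ((t - s) * A).
Proof.
move=> uu ee ue; rewrite /great_circle dot3_comb ![dot3 _ (_ + _)]dot3C !dot3_comb.
by rewrite uu ee [dot3 e u]dot3C ue mulrBl cosB; ring.
Qed.

Lemma edist_great_circle (u e : 'rV[R]_3) A s t :
  dot3 u u = r ^+ 2 -> dot3 e e = r ^+ 2 -> dot3 u e = 0 ->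
  edist (great_circle u e A s) (great_circle u e A t) =
  r * Num.sqrt (2 - 2 * cos ((t - s) * A)).
Proof.
move=> uu ee ue; rewrite -[X in X * _](ger0_norm (ltW r0)) -sqrtr_sqr.
rewrite -sqrtrM ?sqr_ge0//; congr Num.sqrt.
have h1 := dot3_great_circle A s t uu ee ue.
have h2 := dot3_great_circle A s s uu ee ue.
have h3 := dot3_great_circle A t t uu ee ue.
move: h1 h2 h3; rewrite !subrr mul0r cos0 mulr1 !dot3E sum3 => h1 h2 h3.
by lra.
Qed.

Lemma continuous_great_circle (u e : 'rV[R]_3) A : continuous (great_circle u e A).
Proof.
have cm : continuous (fun t : R => t * A) by exact: mulrr_continuous.
have cc : continuous (fun t : R => cos (t * A)).
  by move=> t; apply: (@continuous_comp R R R (fun t : R => t * A) (@cos R));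
    [exact: cm|exact: continuous_cos].
have cs : continuous (fun t : R => sin (t * A)).
  by move=> t; apply: (@continuous_comp R R R (fun t : R => t * A) (@sin R));
    [exact: cm|exact: continuous_sin].
by move=> t; apply: cvgD; apply: cvgZr_tmp; [exact: cc|exact: cs].
Qed.

Lemma intrinsic_distE p q : intrinsic_dist p q = r * angle p q.
Proof.
have [e [ee pe qE]] := great_circle_tangent p q.
set A := angle p q in qE *.
have A0 : 0 <= A by have /andP[] := angle_itv r0 p q.
have gS t : \sum_(i < 3) great_circle (sval p) e A t 0 i ^+ 2 == r ^+ 2.
  apply/eqP; have := dot3_great_circle A t t (dot3_sphere p) ee pe.
  rewrite subrr mul0r cos0 mulr1; apply: etrans; apply: eq_bigr => i _.
  by rewrite expr2.
pose g t : sphere r := exist _ (great_circle (sval p) e A t) (gS t).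
have pg : sphere_path p q g.
  split.
  - exact/continuous_subspaceT/continuous_great_circle.
  - by apply: val_inj; rewrite /= /great_circle mul0r cos0 sin0 scale1r scale0r addr0.
  - by apply: val_inj; rewrite /= /great_circle mul1r -qE.
rewrite /intrinsic_dist.
suff -> : ereal_inf [set curve_length 0 1 (fun t => sval (g t)) | g in sphere_path p q]
   = (r * A)%:E by [].
apply/eqP; rewrite eq_le; apply/andP; split.
  apply: ge_ereal_inf; exists (curve_length 0 1 (fun t => sval (g t))); first by exists g.
  rewrite -[leRHS](_ : (r * A * (1 - 0))%:E = _); last by rewrite subr0 mulr1.
  apply: curve_length_le_lipschitz => x y _ xy _.
  rewrite edist_great_circle ?dot3_sphere// -mulrA ler_pM2l// [A * _]mulrC.
  by apply: chord_le_arc; rewrite mulr_ge0// subr_ge0.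
apply: le_ereal_inf_tmp => _ [f pf <-]; exact: curve_length_ge_angle.
Qed.

End great_circle.

(** * The two magnitudes *)

Section kernel_integrals.
Context {R : realType}.

Definition chordal (r u : R) : R := r * Num.sqrt (2 - 2 * u).

Lemma continuous_chordal (r : R) : continuous (chordal r).
Proof.
have cp : continuous (fun u : R => 2 - 2 * u).
  by move=> u; apply: cvgB; [exact: cvg_cst|apply: cvgMr; exact: cvg_id].
move=> u; apply: cvgMr.
exact: (continuous_comp (cp u) (@sqrt_continuous R _)).
Qed.

Lemma is_derive_chordal (r u : R) : u < 1 ->
  is_derive u 1 (chordal r) (- r / Num.sqrt (2 - 2 * u)).
Proof.
move=> u1; have p0 : 0 < 2 - 2 * u by lra.
have d1 : is_derive u 1 (fun u : R => 2 - 2 * u) (- 2).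
  by apply: is_derive_eq; rewrite /GRing.scale/=; ring.
have d2 := is_derive1_sqrt p0.
have d3 := @is_derive1_comp R Num.sqrt (fun u => 2 - 2 * u) u _ _ d2 d1.
have s0 : Num.sqrt (2 - 2 * u) != 0 by rewrite gt_eqF// sqrtr_gt0.
suff -> : - r / Num.sqrt (2 - 2 * u) = r *: ((2 * Num.sqrt (2 - 2 * u))^-1 * - 2).
  exact: (is_deriveZ r d3).
by rewrite /GRing.scale/=; field.
Qed.

Let exp_poly (a s : R) : R := (1 + s) * expR (- s) * a.

Lemma is_derive_exp_poly (a s : R) :
  is_derive s 1 (exp_poly a) (- (s * expR (- s)) * a).
Proof.
by rewrite /exp_poly; apply: is_derive_eq; rewrite /GRing.scale/=; ring.
Qed.

(** With x = r sqrt (2 - 2 u), an antiderivative of exp (- x) in u is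
    (1 + x) exp (- x) / r ^ 2. *)
Lemma integral_exp_chordal (r : R) : 0 < r ->
  (\int[mu]_(u in [set` `[(-1), 1]%R]) (expR (- chordal r u))%:E)%E =
  ((1 - expR (- (2 * r)) * (1 + 2 * r)) / r ^+ 2)%:E.
Proof.
move=> r0.
have cf : continuous (fun u => expR (- chordal r u)).
  move=> u; apply: (@continuous_comp R R R (fun u => - chordal r u) (@expR R)).
    by apply: cvgN; exact: continuous_chordal.
  exact: continuous_expR.
pose F := exp_poly (r ^- 2) \o chordal r.
have cF : continuous F.
  move=> u; apply: continuous_comp; first exact: continuous_chordal.
  apply: differentiable_continuous; apply/derivable1_diffP.
  by have [] := is_derive_exp_poly (r ^- 2) (chordal r u).
have dF (u : R) : u < 1 -> is_derive u 1 F (expR (- chordal r u)).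
  move=> u1; have s0 : Num.sqrt (2 - 2 * u) != 0.
    by rewrite gt_eqF// sqrtr_gt0; lra.
  suff -> : expR (- chordal r u) = - (chordal r u * expR (- chordal r u)) * r ^- 2 *
      (- r / Num.sqrt (2 - 2 * u)).
    by apply: is_derive1_comp; [exact: is_derive_exp_poly|exact: is_derive_chordal].
  rewrite /chordal; move: (expR _) => w; field.
  by rewrite s0 gt_eqF.
have N11 : -1 < 1 :> R by rewrite (lt_trans (ltrN10 _)).
rewrite (@continuous_FTC2 _ _ F _ _ N11).
- rewrite /F /= /exp_poly /chordal mulr1 subrr sqrtr0 mulr0 oppr0 expR0.
  have -> : 2 - 2 * -1 = 2 ^+ 2 :> R by ring.
  rewrite sqrtr_sqr ger0_norm// -EFinB [r * 2]mulrC; congr (_%:E); ring.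
- exact: continuous_subspaceT.
- split.
  + by move=> u; rewrite in_itv/= => /andP[_ /dF[]].
  + by apply: cvg_at_right_filter; exact: cF.
  + by apply: cvg_at_left_filter; exact: cF.
- move=> u; rewrite in_itv/= => /andP[_ /dF d].
  by rewrite derive1E; apply: derive_val.
Qed.

Let exp_trig (r s : R) : R := expR (- (r * s)) * (r * sin s + cos s) * (1 + r ^+ 2)^-1.

Lemma is_derive_exp_trig (r s : R) :
  is_derive s 1 (exp_trig r) (- (expR (- (r * s)) * sin s)).
Proof.
have r1 : 1 + r ^+ 2 != 0 by rewrite gt_eqF// ltr_pwDl// sqr_ge0.
by rewrite /exp_trig; apply: is_derive_eq; rewrite /GRing.scale/=; field.
Qed.

(** With x = acos u, an antiderivative of exp (- r x) in u is
    exp (- r x) (r sin x + cos x) / (1 + r ^ 2). *)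
Lemma integral_exp_acos (r : R) : 0 < r ->
  (\int[mu]_(u in [set` `[(-1), 1]%R]) (expR (- (r * acos (clip u))))%:E)%E =
  ((1 + expR (- (pi * r))) / (1 + r ^+ 2))%:E.
Proof.
move=> r0.
have N11 : -1 < 1 :> R by rewrite (lt_trans (ltrN10 _)).
have ca := (@continuous_acos_clip R).
have cf : continuous (fun u => expR (- (r * acos (clip u)))).
  move=> u; apply: (@continuous_comp R R R (fun u => - (r * acos (clip u))) (@expR R)).
    by apply: cvgN; apply: cvgMr; exact: ca.
  exact: continuous_expR.
pose F := exp_trig r \o (@acos R).
have cG : continuous (exp_trig r).
  move=> u; apply: differentiable_continuous; apply/derivable1_diffP.
  by have [] := is_derive_exp_trig r u.
have dF (u : R) : -1 < u < 1 -> is_derive u 1 F (expR (- (r * acos (clip u)))).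
  move=> uI; have uI' : -1 <= u <= 1 by case/andP: uI => ? ?; rewrite !ltW.
  have s0 : Num.sqrt (1 - u ^+ 2) != 0.
    by case/andP: uI => ? ?; rewrite gt_eqF// sqrtr_gt0; nra.
  rewrite clip_id//.
  suff -> : expR (- (r * acos u)) = - (expR (- (r * acos u)) * sin (acos u)) *
      (- (Num.sqrt (1 - u ^+ 2))^-1).
    exact: (is_derive1_comp (is_derive_exp_trig r _) (is_derive1_acos uI)).
  by rewrite sin_acos//; field.
have [_ a1 a2] := (continuous_within_itvP _ N11).1 (@within_continuous_acos R).
rewrite (@continuous_FTC2 _ _ F _ _ N11).
- rewrite /F /= /exp_trig acos1 acosN1 sin0 cos0 sinpi cospi !mulr0 oppr0 expR0.
  rewrite -EFinB [pi * r]mulrC; congr (_%:E).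
  have r1 : 1 + r ^+ 2 != 0 by rewrite gt_eqF// ltr_pwDl// sqr_ge0.
  by move: (expR _) => w; field.
- exact: continuous_subspaceT.
- split.
  + by move=> u; rewrite in_itv/= => /dF[].
  + exact: (cvg_comp _ _ a1 (cG _)).
  + exact: (cvg_comp _ _ a2 (cG _)).
- move=> u; rewrite in_itv/= => /dF d.
  by rewrite derive1E; apply: derive_val.
Qed.

End kernel_integrals.

Section magnitudes.
Context {R : realType} {r : R}.
Hypothesis r0 : 0 < r.

Lemma sub_distE (p q : sphere r) : sub_dist p q = chordal r (cosang p q).
Proof. exact: edist_sphere. Qed.

Lemma intrinsic_dist_clip (p q : sphere r) :
  intrinsic_dist p q = r * acos (clip (cosang p q)).
Proof. by rewrite intrinsic_distE// clip_id//; exact: cosang_itv. Qed.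

Lemma edist_le_intrinsic (p q : sphere r) :
  edist (sval p) (sval q) <= intrinsic_dist p q.
Proof.
rewrite edist_sphere// intrinsic_distE// ler_pM2l// -cos_angle//.
by apply: chord_le_arc; have /andP[] := angle_itv r0 p q.
Qed.

Lemma sub_integral_gt0 : 0 < 1 - expR (- (2 * r)) * (1 + 2 * r).
Proof.
rewrite expRN subr_gt0 mulrC ltr_pdivrMr ?expR_gt0// mul1r expR_gt1Dx//.
by rewrite mulf_neq0// gt_eqF.
Qed.

Lemma magnitude_sub :
  has_weight_measure (@sub_dist R r) /\
  magnitude (@sub_dist R r) = 2 * r ^+ 2 / (1 - expR (- (2 * r)) * (1 + 2 * r)).
Proof.
have D0 := sub_integral_gt0.
have J0 : 0 < (1 - expR (- (2 * r)) * (1 + 2 * r)) / r ^+ 2.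
  by rewrite divr_gt0// exprn_gt0.
have h1 : chordal r 1 = 0 by rewrite /chordal mulr1 subrr sqrtr0 mulr0.
have le p q : edist (sval p) (sval q) <= @sub_dist R r p q by [].
have hJ := integral_exp_chordal r0; split.
  exact: (has_weight_measure_radial r0 sub_distE (@continuous_chordal R r) h1 le J0 hJ).
rewrite (magnitude_radial r0 sub_distE (@continuous_chordal R r) h1 le J0 hJ).
by rewrite invf_div mulrA.
Qed.

Lemma magnitude_intrinsic :
  has_weight_measure (@intrinsic_dist R r) /\
  magnitude (@intrinsic_dist R r) = (2 * r ^+ 2 + 2) / (1 + expR (- (pi * r))).
Proof.
have D0 : 0 < 1 + expR (- (pi * r)) by rewrite addr_gt0// expR_gt0.
have J0 : 0 < (1 + expR (- (pi * r))) / (1 + r ^+ 2).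
  by rewrite divr_gt0// ltr_pwDl// sqr_ge0.
have h1 : r * acos (clip 1) = 0.
  by rewrite clip_id ?acos1 ?mulr0// lexx andbT (le_trans (lerN10 _)).
have ch : continuous (fun u => r * acos (clip u)).
  by move=> u; apply: cvgMr; exact: continuous_acos_clip.
have hJ := integral_exp_acos r0; split.
  exact: (has_weight_measure_radial r0 intrinsic_dist_clip ch h1 edist_le_intrinsic J0 hJ).
rewrite (magnitude_radial r0 intrinsic_dist_clip ch h1 edist_le_intrinsic J0 hJ).
by rewrite invf_div mulrA mulrDr mulr1 addrC.
Qed.

End magnitudes.

(** * Asymptotics *)

(** From the fourth-order term of the exponential series,
    exp (2 r) >= (2 r) ^ 4 / 24, and 1 + 2 r <= 3 r. *)
Lemma expRN_le_inv_cube (R : realType) (r x : R) : 1 <= r -> 2 * r <= x ->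
  expR (- x) * (1 + 2 * r) <= 9 / 2 / r ^+ 3.
Proof.
move=> r1 rx; have r0 : 0 < r by lra.
apply: (@le_trans _ _ (expR (- (2 * r)) * (1 + 2 * r))).
  by rewrite ler_wpM2r ?ler_expR ?lerN2//; lra.
have e4 : 2 / 3 * r ^+ 4 <= expR (2 * r).
  have h : 0 <= 2 * r by lra.
  apply: le_trans (expR_ge1Dxn 3 h).
  rewrite (_ : 4`!%:R = 24 :> R)//.
  have -> : 1 + (2 * r) ^+ 4 / 24 = 1 + 2 / 3 * r ^+ 4 by field.
  by rewrite lerDr.
rewrite expRN mulrC ler_pdivrMr ?expR_gt0//.
apply: (@le_trans _ _ (9 / 2 / r ^+ 3 * (2 / 3 * r ^+ 4))); last first.
  by rewrite ler_wpM2l// divr_ge0// exprn_ge0// ltW.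
have -> : 9 / 2 / r ^+ 3 * (2 / 3 * r ^+ 4) = 3 * r by field; rewrite gt_eqF.
by lra.
Qed.

Lemma sqrM_inv_cube (R : realType) (r : R) : 0 < r -> r ^+ 2 * (9 / 2 / r ^+ 3) = 9 / 2 / r.
Proof. by move=> r0; field; rewrite gt_eqF. Qed.

(** With E = exp (- 2 r) (1 + 2 r) the difference is 2 r ^ 2 E / (1 - E), where
    r ^ 2 E <= 9 / (2 r) and E <= 1 / 2. *)
Lemma sub_magnitude_bound (R : realType) (r : R) : 4 <= r ->
  `|2 * r ^+ 2 / (1 - expR (- (2 * r)) * (1 + 2 * r)) - 2 * r ^+ 2| <= 18 / r.
Proof.
move=> r4; have r0 : 0 < r by lra.
have r1 : 1 <= r by lra.
have := expRN_le_inv_cube r1 (lexx _); set E := expR _ * _ => EB.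
have E0 : 0 <= E by rewrite mulr_ge0 ?expR_ge0//; lra.
have r3 : 9 <= r ^+ 3.
  by rewrite (_ : r ^+ 3 = r * r * r); [nra|ring].
have E2 : E <= 1 / 2.
  by apply: le_trans EB _; rewrite ler_pdivrMr ?exprn_gt0//; lra.
have D0 : 0 < 1 - E by lra.
have -> : 2 * r ^+ 2 / (1 - E) - 2 * r ^+ 2 = 2 * (r ^+ 2 * E) / (1 - E).
  by field; rewrite gt_eqF.
have p0 : 0 <= r ^+ 2 * E by rewrite mulr_ge0// sqr_ge0.
rewrite ger0_norm; last by apply: divr_ge0; [rewrite mulr_ge0|exact: ltW].
rewrite ler_pdivrMr//.
have : r ^+ 2 * E <= 9 / 2 / r by rewrite -sqrM_inv_cube// ler_wpM2l// sqr_ge0.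
have : 0 <= r^-1 by rewrite invr_ge0 ltW.
move: (r ^+ 2 * E) (r^-1) => w v v0 wv.
have -> : 18 = 2 * 9 :> R by ring.
by nra.
Qed.

(** With E = exp (- pi r) the difference is - (2 r ^ 2 + 2) E / (1 + E), where
    E <= exp (- 2 r) because pi >= 2. *)
Lemma intrinsic_magnitude_bound (R : realType) (r : R) : 4 <= r ->
  `|(2 * r ^+ 2 + 2) / (1 + expR (- (pi * r))) - (2 * r ^+ 2 + 2)| <= 18 / r.
Proof.
move=> r4; have r0 : 0 < r by lra.
have r1 : 1 <= r by lra.
have pir : 2 * r <= pi * r by rewrite ler_pM2r// pi_ge2.
have := expRN_le_inv_cube r1 pir; set E := expR _ => EB.
have E0 : 0 <= E by rewrite expR_ge0.
have {}EB : E <= 9 / 2 / r ^+ 3.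
  by apply: le_trans EB; rewrite ler_peMr//; lra.
have -> : (2 * r ^+ 2 + 2) / (1 + E) - (2 * r ^+ 2 + 2) = - ((2 * r ^+ 2 + 2) * E / (1 + E)).
  by field; rewrite gt_eqF// ltr_wpDr.
have rr : 1 <= r ^+ 2 by nra.
have D0 : 0 < 1 + E by lra.
rewrite normrN ger0_norm; last first.
  by apply: divr_ge0; [apply: mulr_ge0 => //; lra|exact: ltW].
rewrite ler_pdivrMr//.
have rE : r ^+ 2 * E <= 9 / 2 / r by rewrite -sqrM_inv_cube// ler_wpM2l// sqr_ge0.
have v0 : 0 <= r^-1 by rewrite invr_ge0 ltW.
have : 0 <= r^-1 * E by rewrite mulr_ge0.
by nra.
Qed.

Section vanishing.
Context {R : realType} (f g : R -> R) (K : R).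
Hypothesis fg : forall r, 4 <= r -> `|f r - g r| <= K / r.

Lemma eqaddO_inv : (f : R -> R^o) = g +O_ (pinfty_nbhs R) (fun r : R => r^-1 : R^o).
Proof.
apply/eqaddOP; near=> k; near=> r.
have r4 : 4 <= r by near: r; apply: nbhs_pinfty_ge; rewrite num_real.
have r0 : 0 <= r^-1 by rewrite invr_ge0; lra.
rewrite (le_trans (fg r4))// (ger0_norm r0) ler_wpM2r//.
Unshelve. all: by end_near. Qed.

Lemma cvg_diff0 : f r - g r @[r --> +oo] --> 0.
Proof.
apply: norm_cvg0; apply: (@squeeze_cvgr _ _ _ _ (cst 0) (fun r => K / r)).
- near=> r; rewrite normr_ge0 fg//.
- exact: cvg_cst.
- rewrite -[X in _ --> X](mulr0 K); apply: cvgMr.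
  apply/gtr0_cvgV0; last exact: cvg_id.
  by near=> r; near: r; apply: nbhs_pinfty_gt; rewrite num_real.
Unshelve. all: by end_near. Qed.

End vanishing.

Theorem theorem12 (R : realType) :
  let mag_sub (r : R) : R := magnitude (@sub_dist R r) in
  let mag_int (r : R) : R := magnitude (@intrinsic_dist R r) in
  [/\ forall r : R, 0 < r ->
        has_weight_measure (@sub_dist R r) /\
        mag_sub r = 2 * r ^+ 2 / (1 - expR (- (2 * r)) * (1 + 2 * r)),
      (mag_sub : R -> R^o) = (fun r : R => 2 * r ^+ 2)
        +O_ (pinfty_nbhs R) (fun r : R => r^-1 : R^o),
      forall r : R, 0 < r ->
        has_weight_measure (@intrinsic_dist R r) /\
        mag_int r = (2 * r ^+ 2 + 2) / (1 + expR (- (pi * r))),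
      (mag_int : R -> R^o) = (fun r : R => 2 * r ^+ 2 + 2)
        +O_ (pinfty_nbhs R) (fun r : R => r^-1 : R^o)
    & exists c c' : R,
        [/\ mag_sub r - 2 * r ^+ 2 @[r --> +oo] --> c,
            mag_int r - 2 * r ^+ 2 @[r --> +oo] --> c'
          & c <> c']].
Proof.
move=> mag_sub mag_int.
have Bs (r : R) : 4 <= r -> `|mag_sub r - 2 * r ^+ 2| <= 18 / r.
  move=> r4; have r0 : 0 < r by lra.
  by rewrite /mag_sub (magnitude_sub r0).2; exact: sub_magnitude_bound.
have Bi (r : R) : 4 <= r -> `|mag_int r - (2 * r ^+ 2 + 2)| <= 18 / r.
  move=> r4; have r0 : 0 < r by lra.
  by rewrite /mag_int (magnitude_intrinsic r0).2; exact: intrinsic_magnitude_bound.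
split.
- by move=> r r0; exact: magnitude_sub.
- exact: eqaddO_inv Bs.
- by move=> r r0; exact: magnitude_intrinsic.
- exact: eqaddO_inv Bi.
- exists 0, 2; split.
  + exact: (@cvg_diff0 R mag_sub (fun r => 2 * r ^+ 2) 18 Bs).
  + have -> : (fun r => mag_int r - 2 * r ^+ 2) =
        (fun r => (mag_int r - (2 * r ^+ 2 + 2)) + 2).
      by apply/funext => r; ring.
    rewrite -[X in _ --> X]add0r; apply: cvgD; last exact: cvg_cst.
    exact: (@cvg_diff0 R mag_int (fun r => 2 * r ^+ 2 + 2) 18 Bi).
  + by apply/eqP; rewrite lt_eqF.
Qed.
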